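(* Let $F$ be a multiplicatively Archimedean fully preordered semifield with an element $u\in F^\times$, $u>1$, such that: \begin{itemize} \item $F$ is of max-temperate or max-tropical type. \item $F/\!\sim$ has quasi-complements. \end{itemize} Then there is a homomorphism $\phi:F\to\mathbb{K}$ with $\mathbb{K}\in\{\mathbb{R}_+,\mathbb{TR}_+\}$ such that for all $x\sim y$ in $F$, we have \[ x\le y\quad\Longleftrightarrow\quad\phi(x)\le\phi(y). \]
   Context: All semirings are commutative with $0$ (absorbing) and $1$, and homomorphisms are semiring homomorphisms; $\mathbb{N}\ni0$, and $n\in\mathbb{N}$ also denotes the element $n\cdot1$ of a semiring. A semifield is a semiring $F$ whose multiplicatively invertible elements are exactly the nonzero ones; $F^\times=F\setminus\{0\}$. For a preorder $\le$: $x\approx y$ means $x\le y$ and $y\le x$; $x<y$ means $x\le y$ and not $y\le x$; $\sim$ is the equivalence relation generated by $\le$. A preordered semifield is a semifield with a preorder such that addition by $a$ and multiplication by $a$ are monotone for every $a$, and such that $x\approx0$ implies $x=0$. $F/\!\sim$ is the quotient semiring. The preorder is full (and $F$ is fully preordered) if $x\sim y$ implies $x\le y$ or $x\ge y$. $F$ is multiplicatively Archimedean if for all $x,y\in F^\times$: if $x^k\le y$ for all $k\in\mathbb{N}$, then $x\le1$. $F$ is max-tropical if $x+x^{-1}\approx2x$ for all $x\in F^\times$ with $x>1$, and max-temperate if $2<x+x^{-1}<2x$ for all $x\in F^\times$ with $x>1$. A semiring $T$ has quasi-complements if for every $x\in T$ there are $y\in T$ and $n\in\mathbb{N}$ with $x+y=n$.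 $\mathbb{R}_+=[0,\infty)$ with the usual operations and order; $\mathbb{TR}_+=([0,\infty),\max,\cdot)$ with the usual order. *)

(* Defs.v *)
From HB Require Import structures.
From Stdlib Require Import Relation_Operators.
From mathcomp Require Import all_boot all_order all_algebra.
From mathcomp Require Import boolp classical_sets reals.

Set Implicit Arguments.
Unset Strict Implicit.
Unset Printing Implicit Defensive.

Import Order.TTheory GRing.Theory Num.Theory.
Local Open Scope ring_scope.
Local Open Scope quotient_scope.

HB.mixin Record isSemifield F of GRing.ComPzSemiRing F := {
  semifield_invertible : forall x : F, (exists y, x * y = 1) <-> x <> 0
}.

#[short(type="semifieldType")]
HB.structure Definition Semifield :=
  { F of isSemifield F & GRing.ComPzSemiRing F }.

(* The preorder is not an [Order.Preorder] instance because mathcomp-algebra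
   already joins that class with addition in [Num.POrderedZmodule], which has
   opposites; HB then rejects a preordered semiring without them. *)
HB.mixin Record isPreorderedSemifield F of Semifield F := {
  psf_le : F -> F -> Prop;
  psf_le_refl : forall x, psf_le x x;
  psf_le_trans : forall x y z, psf_le x y -> psf_le y z -> psf_le x z;
  psf_add_mono : forall a x y : F, psf_le x y -> psf_le (a + x) (a + y);
  psf_mul_mono : forall a x y : F, psf_le x y -> psf_le (a * x) (a * y);
  psf_eqv0 : forall x : F, psf_le x 0 -> psf_le 0 x -> x = 0
}.

#[short(type="preorderedSemifieldType")]
HB.structure Definition PreorderedSemifield :=
  { F of isPreorderedSemifield F & Semifield F }.

Declare Scope psf_scope.
Local Open Scope psf_scope.

Notation "x <=p y" := (psf_le x y) (at level 70) : psf_scope.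
Notation "x <p y" := (psf_le x y /\ ~ psf_le y x) (at level 70) : psf_scope.
Notation "x =p y" := (psf_le x y /\ psf_le y x) (at level 70) : psf_scope.

(* MathComp's [x^-1] needs a ring, so the inverse is defined here;
   [sinv 0 = 0]. *)
Definition sinv (F : semifieldType) (x : F) : F := xget 0 [set y | x * y = 1]%classic.

Lemma mulf_sinv (F : semifieldType) (x : F) : x <> 0 -> x * sinv x = 1.
Proof.
move=> /semifield_invertible [y xy1]; rewrite /sinv.
by case: xgetP => [z _ //|/(_ y)].
Qed.

Section Preordered.
Variable F : preorderedSemifieldType.
Implicit Types x y : F.

Definition sim : F -> F -> Prop := clos_refl_sym_trans F psf_le.

Definition fully_preordered : Prop :=
  forall x y, sim x y -> x <=p y \/ y <=p x.

Definition mult_archimedean : Prop :=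
  forall x y, x <> 0 -> y <> 0 -> (forall k : nat, x ^+ k <=p y) -> x <=p 1.

Definition max_tropical : Prop :=
  forall x, x <> 0 -> 1 <p x -> x + sinv x =p 2 * x.

Definition max_temperate : Prop :=
  forall x, x <> 0 -> 1 <p x -> 2 <p x + sinv x /\ x + sinv x <p 2 * x.

Lemma sim_addl a x y : sim x y -> sim (a + x) (a + y).
Proof.
elim=> [{}x {}y xy|{}x|{}x {}y _|{}x {}y z _ xy _ yz].
- exact/rst_step/psf_add_mono.
- exact: rst_refl.
- exact: rst_sym.
- exact: rst_trans xy yz.
Qed.

Lemma sim_mull a x y : sim x y -> sim (a * x) (a * y).
Proof.
elim=> [{}x {}y xy|{}x|{}x {}y _|{}x {}y z _ xy _ yz].
- exact/rst_step/psf_mul_mono.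
- exact: rst_refl.
- exact: rst_sym.
- exact: rst_trans xy yz.
Qed.

Lemma sim_add x x' y y' : sim x x' -> sim y y' -> sim (x + y) (x' + y').
Proof.
move=> xx' yy'; apply: rst_trans (sim_addl x yy') _.
by rewrite ![_ + y']addrC; apply: sim_addl.
Qed.

Lemma sim_mul x x' y y' : sim x x' -> sim y y' -> sim (x * y) (x' * y').
Proof.
move=> xx' yy'; apply: rst_trans (sim_mull x yy') _.
by rewrite ![_ * y']mulrC; apply: sim_mull.
Qed.

Definition simb : rel F := fun x y => `[< sim x y >].

Lemma simb_refl : reflexive simb.
Proof. by move=> x; apply/asboolP/rst_refl. Qed.

Lemma simb_sym : symmetric simb.
Proof. by move=> x y; apply/asboolP/asboolP; apply: rst_sym. Qed.

Lemma simb_trans : transitive simb.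
Proof. by move=> y x z /asboolP xy /asboolP yz; apply/asboolP/(rst_trans _ _ _ _ _ xy yz). Qed.

Canonical simb_equiv := EquivRel simb simb_refl simb_sym simb_trans.

Definition sim_quot := {eq_quot simb}.

HB.instance Definition _ := Choice.on sim_quot.
HB.instance Definition _ := EqQuotient.on sim_quot.

Definition sq_zero : sim_quot := \pi_sim_quot 0.
Definition sq_one : sim_quot := \pi_sim_quot 1.
Definition sq_add (a b : sim_quot) : sim_quot := \pi_sim_quot (repr a + repr b).
Definition sq_mul (a b : sim_quot) : sim_quot := \pi_sim_quot (repr a * repr b).

Lemma sim_repr x : sim (repr (\pi_sim_quot x)) x.
Proof. by apply/asboolP; rewrite -[`[< _ >]]/(simb _ _) -(eqquotE sim_quot) reprK. Qed.

Lemma sq_addE x y : sq_add (\pi_sim_quot x) (\pi_sim_quot y) = \pi_sim_quot (x + y).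
Proof. apply/eqquotP/asboolP/sim_add; exact: sim_repr. Qed.

Lemma sq_mulE x y : sq_mul (\pi_sim_quot x) (\pi_sim_quot y) = \pi_sim_quot (x * y).
Proof. apply/eqquotP/asboolP/sim_mul; exact: sim_repr. Qed.

Lemma sq_surj (a : sim_quot) : exists x, a = \pi_sim_quot x.
Proof. by exists (repr a); rewrite reprK. Qed.

Lemma sq_addA : associative sq_add.
Proof.
move=> a b c; have [[x ->] [y ->] [z ->]] := And3 (sq_surj a) (sq_surj b) (sq_surj c).
by rewrite !sq_addE addrA.
Qed.
Lemma sq_addC : commutative sq_add.
Proof. by move=> a b; have [[x ->] [y ->]] := conj (sq_surj a) (sq_surj b); rewrite !sq_addE addrC. Qed.
Lemma sq_add0 : left_id sq_zero sq_add.
Proof. by move=> a; have [x ->] := sq_surj a; rewrite sq_addE add0r. Qed.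
Lemma sq_mulA : associative sq_mul.
Proof.
move=> a b c; have [[x ->] [y ->] [z ->]] := And3 (sq_surj a) (sq_surj b) (sq_surj c).
by rewrite !sq_mulE mulrA.
Qed.
Lemma sq_mulC : commutative sq_mul.
Proof. by move=> a b; have [[x ->] [y ->]] := conj (sq_surj a) (sq_surj b); rewrite !sq_mulE mulrC. Qed.
Lemma sq_mul1 : left_id sq_one sq_mul.
Proof. by move=> a; have [x ->] := sq_surj a; rewrite sq_mulE mul1r. Qed.
Lemma sq_mulDl : left_distributive sq_mul sq_add.
Proof.
move=> a b c; have [[x ->] [y ->] [z ->]] := And3 (sq_surj a) (sq_surj b) (sq_surj c).
by rewrite !(sq_addE, sq_mulE) mulrDl.
Qed.
Lemma sq_mul0 : left_zero sq_zero sq_mul.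
Proof. by move=> a; have [x ->] := sq_surj a; rewrite sq_mulE mul0r. Qed.

HB.instance Definition _ := GRing.isNmodule.Build sim_quot sq_addA sq_addC sq_add0.
HB.instance Definition _ := GRing.Nmodule_isComPzSemiRing.Build sim_quot
  sq_mulA sq_mulC sq_mul1 sq_mulDl sq_mul0.

End Preordered.

Definition quasi_complements (T : comPzSemiRingType) : Prop :=
  forall x : T, exists (y : T) (n : nat), x + y = n%:R.

Section NonnegReals.
Variable R : realType.

Record Rplus := MkRplus { Rplus_val : R; Rplus_ge0 : 0 <= Rplus_val }.
HB.instance Definition _ := [isSub of Rplus for Rplus_val].
HB.instance Definition _ := [Choice of Rplus by <:].

Lemma nneg_semiring_closed : semiring_closed [pred x : R | 0 <= x].
Proof.
by split; split=> [|x y]; rewrite ?inE //; [exact: addr_ge0|exact: mulr_ge0].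
Qed.

HB.instance Definition _ :=
  GRing.SubChoice_isSubComPzSemiRing.Build R _ Rplus nneg_semiring_closed.

Lemma Rplus_invertible (x : Rplus) : (exists y, x * y = 1) <-> x <> 0.
Proof.
split=> [[y /(congr1 val)]|x0].
  rewrite !SubK /= => xy1 x0; move: xy1; rewrite x0 /= mul0r => /esym/eqP.
  by rewrite oner_eq0.
have vx0 : val x != 0 by apply/eqP=> vx0; apply/x0/val_inj.
have nx : 0 <= (val x)^-1 by rewrite invr_ge0 Rplus_ge0.
by exists (MkRplus nx); apply/val_inj; rewrite /= divff.
Qed.

HB.instance Definition _ := isSemifield.Build Rplus Rplus_invertible.

Definition Rplus_le (x y : Rplus) : Prop := val x <= val y.

Lemma Rplus_le_refl x : Rplus_le x x.
Proof. exact: lexx. Qed.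
Lemma Rplus_le_trans x y z : Rplus_le x y -> Rplus_le y z -> Rplus_le x z.
Proof. exact: le_trans. Qed.
Lemma Rplus_add_mono a x y : Rplus_le x y -> Rplus_le (a + x) (a + y).
Proof. by move=> xy; rewrite /Rplus_le /= lerD2l. Qed.
Lemma Rplus_mul_mono a x y : Rplus_le x y -> Rplus_le (a * x) (a * y).
Proof. by move=> xy; rewrite /Rplus_le /= ler_wpM2l // Rplus_ge0. Qed.
Lemma Rplus_eqv0 x : Rplus_le x 0 -> Rplus_le 0 x -> x = 0.
Proof. by move=> x0 xx; apply/val_inj/le_anti/andP. Qed.

HB.instance Definition _ := isPreorderedSemifield.Build Rplus Rplus_le_refl
  Rplus_le_trans Rplus_add_mono Rplus_mul_mono Rplus_eqv0.

Record TRplus := MkTRplus { TRplus_val : R; TRplus_ge0 : 0 <= TRplus_val }.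
HB.instance Definition _ := [isSub of TRplus for TRplus_val].
HB.instance Definition _ := [Choice of TRplus by <:].

Implicit Types x y z : TRplus.

Lemma TRplus_max_ge0 x y : 0 <= Num.max (val x) (val y).
Proof. by rewrite le_max TRplus_ge0. Qed.

Definition TRplus_zero : TRplus := MkTRplus (lexx 0).
Definition TRplus_one : TRplus := MkTRplus ler01.
Definition TRplus_add x y : TRplus := MkTRplus (TRplus_max_ge0 x y).
Definition TRplus_mul x y : TRplus := MkTRplus (mulr_ge0 (TRplus_ge0 x) (TRplus_ge0 y)).

Lemma TRplus_addA : associative TRplus_add.
Proof. by move=> x y z; apply/val_inj; rewrite /= maxA. Qed.
Lemma TRplus_addC : commutative TRplus_add.
Proof. by move=> x y; apply/val_inj; rewrite /= maxC. Qed.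
Lemma TRplus_add0 : left_id TRplus_zero TRplus_add.
Proof. by move=> x; apply/val_inj/max_r/TRplus_ge0. Qed.
Lemma TRplus_mulA : associative TRplus_mul.
Proof. by move=> x y z; apply/val_inj; rewrite /= mulrA. Qed.
Lemma TRplus_mulC : commutative TRplus_mul.
Proof. by move=> x y; apply/val_inj; rewrite /= mulrC. Qed.
Lemma TRplus_mul1 : left_id TRplus_one TRplus_mul.
Proof. by move=> x; apply/val_inj; rewrite /= mul1r. Qed.
Lemma TRplus_mulDl : left_distributive TRplus_mul TRplus_add.
Proof. by move=> x y z; apply/val_inj; rewrite /= maxr_pMl // TRplus_ge0. Qed.
Lemma TRplus_mul0 : left_zero TRplus_zero TRplus_mul.
Proof. by move=> x; apply/val_inj; rewrite /= mul0r. Qed.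

HB.instance Definition _ :=
  GRing.isNmodule.Build TRplus TRplus_addA TRplus_addC TRplus_add0.
HB.instance Definition _ := GRing.Nmodule_isComPzSemiRing.Build TRplus
  TRplus_mulA TRplus_mulC TRplus_mul1 TRplus_mulDl TRplus_mul0.

Lemma TRplus_invertible x : (exists y, x * y = 1) <-> x <> 0.
Proof.
split=> [[y /(congr1 val) /=]|x0].
  by move=> xy1 x0; move: xy1; rewrite x0 /= mul0r => /esym/eqP; rewrite oner_eq0.
have vx0 : val x != 0 by apply/eqP=> vx0; apply/x0/val_inj.
have nx : 0 <= (val x)^-1 by rewrite invr_ge0 TRplus_ge0.
by exists (MkTRplus nx); apply/val_inj; rewrite /= divff.
Qed.

HB.instance Definition _ := isSemifield.Build TRplus TRplus_invertible.

Definition TRplus_le x y : Prop := val x <= val y.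

Lemma TRplus_le_refl x : TRplus_le x x.
Proof. exact: lexx. Qed.
Lemma TRplus_le_trans x y z : TRplus_le x y -> TRplus_le y z -> TRplus_le x z.
Proof. exact: le_trans. Qed.
Lemma TRplus_add_mono a x y : TRplus_le x y -> TRplus_le (a + x) (a + y).
Proof. by move=> xy; rewrite /TRplus_le /= ge_max !le_max lexx (xy : val x <= val y) orbT. Qed.
Lemma TRplus_mul_mono a x y : TRplus_le x y -> TRplus_le (a * x) (a * y).
Proof. by move=> xy; rewrite /TRplus_le /= ler_wpM2l // TRplus_ge0. Qed.
Lemma TRplus_eqv0 x : TRplus_le x 0 -> TRplus_le 0 x -> x = 0.
Proof. by move=> x0 xx; apply/val_inj/le_anti/andP. Qed.

HB.instance Definition _ := isPreorderedSemifield.Build TRplus TRplus_le_refl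
  TRplus_le_trans TRplus_add_mono TRplus_mul_mono TRplus_eqv0.

End NonnegReals.

(* Main.v *)
From HB Require Import structures.
From Stdlib Require Import Relation_Operators.
Require Import Defs.
From mathcomp Require Import all_boot all_order all_algebra.
From mathcomp Require Import boolp classical_sets reals sequences exp.
From mathcomp Require Import ring lra zify.

Set Implicit Arguments.
Unset Strict Implicit.
Unset Printing Implicit Defensive.

Import Order.TTheory GRing.Theory Num.Theory.
Local Open Scope ring_scope.
Local Open Scope psf_scope.

(** The order can only see inside a class of [~], so real numbers have to come
    from totally ordered objects attached to these classes.  Both cases use
    Hoelder's theorem: a totally ordered cancellative Archimedean commutative
    monoid embeds into the additive reals, and its monotone additive functionals
    are the multiples of that embedding ([le_hoelder], [hoelder_unique]).  The
    two cases apply it to different monoids.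

    Max-temperate case.  The monoid consists of the pairs [(a, b)] with [a ~ b],
    read as differences [a - b] and compared by [a + d <= c + b].  All elements
    [a + d] and [c + b] are [~]-related, so this relation is total.  Let
    [delta] be the Hoelder embedding with [delta (u - 1) = 1], and put
    [phi x := delta (x u - x)].  It is additive by construction.  Multiplication
    by [x] is a monotone endomorphism of the monoid, hence acts on [delta] as a
    scalar, which must be [phi x]; so [phi] is multiplicative, and
    [phi x - phi y = (phi u - 1) delta (x - y)] gives the order statement.  The
    work lies in the hypotheses of Hoelder's theorem: the preorder is
    cancellative ([psf_le_add2r]), and every difference is bounded by a multiple
    of every positive [g - 1] ([sim_bounded]).  Both rest on quasi-complements,
    which replace an arbitrary summand by a multiple of some [h ~ 1].

    Max-tropical case.  Cancellation fails here.  Instead [x] is said to absorb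
    [z] when shrinking [z] by a factor [d ~ 1] does not change [x + z]; this is
    [phi z <= phi x] for the map to be found, and it is total even between
    elements which the given preorder cannot compare ([absorbs_total]).  With
    it, the nonzero elements under multiplication satisfy Hoelder's theorem, and
    [phi] is the exponential of the embedding.  Sums go to maxima because [x]
    and [x + z] absorb each other as soon as [x] absorbs [z].

    Below, [g], [h], [q], ... mostly stand for nonzero elements that are
    [~]-related to 1.  They form a totally preordered group, and
    [x ~ y] between nonzero elements means [x = y g] for such a [g]. *)

(** * Hoelder's embedding theorem *)

(** The preorder is only required to behave on a part [C] of [M], and
    [ap_arch] avoids subtraction, so that the lemmas below apply both to pairs
    read as formal differences and to nonzero elements under multiplication.
    The element [e] is the unit of measurement. *)
Record archimedean_preorder (M : nmodType) (C : M -> Prop)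
    (le : M -> M -> Prop) (e : M) : Prop := ArchimedeanPreorder {
  ap_C0 : C 0;
  ap_CD : forall x y, C x -> C y -> C (x + y);
  ap_Ce : C e;
  ap_trans : forall x y z, C x -> C y -> C z -> le x y -> le y z -> le x z;
  ap_total : forall x y, C x -> C y -> le x y \/ le y x;
  ap_add : forall x y z, C x -> C y -> C z -> le (x + z) (y + z) <-> le x y;
  ap_pos : ~ le e 0;
  ap_bound : forall x, C x -> exists n, le x (e *+ n) /\ le 0 (x + e *+ n);
  ap_arch : forall x y, C x -> C y -> ~ le x y ->
    exists n, le (y *+ n + e) (x *+ n)
}.

Lemma ratio_between (R : realType) (a b : R) : a < b ->
  exists p q m : nat, a < (p%:R - q%:R) / m.+1%:R < b.
Proof.
move=> ab; have [r /andP[ar rb]] := rat_in_itvoo ab.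
exists (if numq r is Posz n then n else 0%N),
  (if numq r is Negz n then n.+1 else 0%N), (`|denq r|.-1)%N.
rewrite prednK ?absz_gt0 ?denq_neq0 //.
suff -> : ((if numq r is Posz n then n else 0%N)%:R
   - (if numq r is Negz n then n.+1 else 0%N)%:R) / (`|denq r|%N)%:R = ratr r :> R.
  by apply/andP; split.
rewrite /ratr; congr (_ / _).
  by case: (numq r) => n; rewrite ?subr0 // sub0r.
by rewrite -[in RHS](gez0_abs (denq_ge0 r)).
Qed.

Section Hoelder.
Variables (R : realType) (M : nmodType) (C : M -> Prop).
Variables (le : M -> M -> Prop) (e : M).
Hypothesis ap : archimedean_preorder C le e.

Let Ce : C e := ap_Ce ap.

Lemma ap_Cmuln x n : C x -> C (x *+ n).
Proof.
move=> Cx; elim: n => [|n IHn]; first exact: ap_C0 ap.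
by rewrite mulrS; apply: (ap_CD ap).
Qed.

Local Hint Resolve Ce ap_Cmuln : core.
Let CD := ap_CD ap.
Let C0 : C 0 := ap_C0 ap.
Local Hint Resolve C0 CD : core.

Lemma ap_refl x : C x -> le x x.
Proof. by move=> Cx; case: (ap_total ap Cx Cx). Qed.

Lemma ap_leD x y z w : C x -> C y -> C z -> C w ->
  le x y -> le z w -> le (x + z) (y + w).
Proof.
move=> Cx Cy Cz Cw xy zw; apply: (ap_trans ap (y := y + z)); auto.
  by apply/(ap_add ap).
by rewrite ![y + _]addrC; apply/(ap_add ap).
Qed.

Lemma ap_leMn x y n : C x -> C y -> le x y -> le (x *+ n) (y *+ n).
Proof.
move=> Cx Cy xy; elim: n => [|n IHn]; first exact: ap_refl.
by rewrite !mulrS; apply: ap_leD; auto.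
Qed.

Lemma ap_ltMn x y n : C x -> C y ->
  ~ le y x -> ~ le (y *+ n.+1) (x *+ n.+1).
Proof.
move=> Cx Cy yx yxn; have [//|xy] := ap_total ap Cy Cx.
apply: yx.
apply/(ap_add ap (z := x *+ n)); auto; rewrite -mulrS.
apply: (ap_trans ap (y := y *+ n.+1)); auto; rewrite [y *+ _.+1]mulrS.
rewrite ![y + _]addrC; apply/(ap_add ap); auto.
exact: ap_leMn.
Qed.

Lemma ap_unit_leMn n p q : le (e *+ p + n) (e *+ q + n) -> C n -> (p <= q)%N.
Proof.
move=> + Cn; move/(ap_add ap)=> /(_ (ap_Cmuln p Ce) (ap_Cmuln q Ce) Cn) pq.
rewrite leqNgt; apply/negP => qp.
have := @ap_ltMn 0 e (p - q.+1)%N C0 Ce (ap_pos ap); rewrite mul0rn; apply.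
apply/(ap_add ap (z := e *+ q)); auto.
by rewrite -mulrnDr add0r (_ : ((p - q.+1).+1 + q = p)%N) //; lia.
Qed.

(** A Dedekind cut: fractions [(p - q) / m] with [p e <= m x + q e] lie below those
    with the opposite inequality, by clearing denominators. *)
Lemma lower_le_upper x p q m p' q' m' : C x -> (0 < m)%N -> (0 < m')%N ->
  le (e *+ p) (x *+ m + e *+ q) -> le (x *+ m' + e *+ q') (e *+ p') ->
  (p%:R - q%:R) / m%:R <= (p'%:R - q'%:R) / m'%:R :> R.
Proof.
move=> Cx m0 m'0 lo up.
have: le (e *+ (p * m' + q' * m) + 0) (e *+ (p' * m + q * m') + 0).
  have lo' := ap_leMn m' (ap_Cmuln p Ce) (CD (ap_Cmuln m Cx) (ap_Cmuln q Ce)) lo.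
  have up' := ap_leMn m (CD (ap_Cmuln m' Cx) (ap_Cmuln q' Ce)) (ap_Cmuln p' Ce) up.
  rewrite !addr0 !mulrnDr !mulrnA.
  apply: (ap_trans ap (y := (x *+ m + e *+ q) *+ m' + e *+ q' *+ m)); auto.
    by apply: ap_leD; auto; apply: ap_refl; auto.
  rewrite !mulrnDl -addrA [e *+ q *+ m' + _]addrC addrA.
  apply: ap_leD; auto; last by apply: ap_refl; auto.
  by move: up'; rewrite mulrnDl -!mulrnA [(m * m')%N]mulnC.
move/ap_unit_leMn => /(_ C0); rewrite -(ler_nat R) !natrD !natrM => h.
rewrite ler_pdivrMr ?ltr0n // mulrAC ler_pdivlMr ?ltr0n //; lra.
Qed.

Definition hoelder (x : M) : R :=
  sup [set r | exists p q m : nat, [/\ (0 < m)%N, r = (p%:R - q%:R) / m%:R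
                                & le (e *+ p) (x *+ m + e *+ q)]]%classic.

Lemma hoelder_lower x p q m : C x -> (0 < m)%N ->
  le (e *+ p) (x *+ m + e *+ q) -> (p%:R - q%:R) / m%:R <= hoelder x.
Proof.
move=> Cx m0 lo; apply: ub_le_sup; last by exists p, q, m.
have [n [xn _]] := ap_bound ap Cx.
exists ((n%:R - 0%:R) / 1%:R) => _ [p' [q' [m' [m'0 -> lo']]]].
by apply: lower_le_upper lo' _; rewrite // addr0.
Qed.

Lemma hoelder_upper x p q m : C x -> (0 < m)%N ->
  le (x *+ m + e *+ q) (e *+ p) -> hoelder x <= (p%:R - q%:R) / m%:R.
Proof.
move=> Cx m0 up; apply: ge_sup; last first.
  by move=> _ [p' [q' [m' [m'0 -> lo']]]]; apply: lower_le_upper lo' up.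
have [n [_ xn]] := ap_bound ap Cx.
by exists ((0%:R - n%:R) / 1%:R), 0%N, n, 1%N.
Qed.

Lemma lt_hoelder x p q m : C x -> (0 < m)%N ->
  (p%:R - q%:R) / m%:R < hoelder x -> le (e *+ p) (x *+ m + e *+ q).
Proof.
move=> Cx m0 lt; have [//|up] := ap_total ap (ap_Cmuln p Ce)
  (CD (ap_Cmuln m Cx) (ap_Cmuln q Ce)).
by have := hoelder_upper Cx m0 up; rewrite leNgt lt.
Qed.

Lemma gt_hoelder x p q m : C x -> (0 < m)%N ->
  hoelder x < (p%:R - q%:R) / m%:R -> le (x *+ m + e *+ q) (e *+ p).
Proof.
move=> Cx m0 lt; have [lo|//] := ap_total ap (ap_Cmuln p Ce)
  (CD (ap_Cmuln m Cx) (ap_Cmuln q Ce)).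
by have := hoelder_lower Cx m0 lo; rewrite leNgt lt.
Qed.

Let scaleD x y (q m q' m' : nat) :
  (x *+ m + e *+ q) *+ m' + (y *+ m' + e *+ q') *+ m =
  (x + y) *+ (m * m') + e *+ (q * m' + q' * m).
Proof.
by rewrite !mulrnDl !mulrnDr -!mulrnA [(m' * m)%N]mulnC addrACA.
Qed.

Let ratioD (p q m p' q' m' : nat) :
  ((p * m'.+1 + p' * m.+1)%:R - (q * m'.+1 + q' * m.+1)%:R) /
    (m.+1 * m'.+1)%:R
  = (p%:R - q%:R) / m.+1%:R + (p'%:R - q'%:R) / m'.+1%:R :> R.
Proof.
have : m.+1%:R != 0 :> R by rewrite pnatr_eq0.
have : m'.+1%:R != 0 :> R by rewrite pnatr_eq0.
move: m.+1 m'.+1 => {}m {}m' m0 m'0.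
by rewrite !natrD !natrM; field; rewrite m0.
Qed.

(** Additivity holds because lower (resp. upper) fractions of [x] and [y] add up to
    lower (resp. upper) fractions of [x + y]. *)
Lemma hoelderD x y : C x -> C y -> hoelder (x + y) = hoelder x + hoelder y.
Proof.
move=> Cx Cy; apply/le_anti/andP; split; rewrite leNgt; apply/negP => lt.
  have r0 : hoelder x < hoelder (x + y) - hoelder y by lra.
  have [p [q [m /andP[r1 r2]]]] := ratio_between r0.
  set r := (p%:R - q%:R) / _ in r1 r2.
  have s0 : hoelder y < hoelder (x + y) - r by lra.
  have [p' [q' [m' /andP[s1 s2]]]] := ratio_between s0.
  have lx := ap_leMn m'.+1 (CD (ap_Cmuln m.+1 Cx) (ap_Cmuln q Ce))
    (ap_Cmuln p Ce) (gt_hoelder Cx (ltn0Sn m) r1).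
  have ly := ap_leMn m.+1 (CD (ap_Cmuln m'.+1 Cy) (ap_Cmuln q' Ce))
    (ap_Cmuln p' Ce) (gt_hoelder Cy (ltn0Sn m') s1).
  have := ap_leD _ _ _ _ lx ly; rewrite scaleD // -!mulrnA -mulrnDr => lxy.
  have := @hoelder_upper (x + y) _ _ (m.+1 * m'.+1) (CD Cx Cy) isT (lxy _ _ _ _).
  rewrite ratioD -/r => h; have := h ltac:(auto) ltac:(auto) ltac:(auto) ltac:(auto).
  by rewrite leNgt -ltrBrDl s2.
have r0 : hoelder (x + y) - hoelder y < hoelder x by lra.
have [p [q [m /andP[r1 r2]]]] := ratio_between r0.
set r := (p%:R - q%:R) / _ in r1 r2.
have s0 : hoelder (x + y) - r < hoelder y by lra.
have [p' [q' [m' /andP[s1 s2]]]] := ratio_between s0.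
have lx := ap_leMn m'.+1 (ap_Cmuln p Ce) (CD (ap_Cmuln m.+1 Cx) (ap_Cmuln q Ce))
  (lt_hoelder Cx (ltn0Sn m) r2).
have ly := ap_leMn m.+1 (ap_Cmuln p' Ce) (CD (ap_Cmuln m'.+1 Cy) (ap_Cmuln q' Ce))
  (lt_hoelder Cy (ltn0Sn m') s2).
have := ap_leD _ _ _ _ lx ly; rewrite scaleD // -!mulrnA -mulrnDr => lxy.
have := @hoelder_lower (x + y) _ _ (m.+1 * m'.+1) (CD Cx Cy) isT (lxy _ _ _ _).
rewrite ratioD -/r => h; have := h ltac:(auto) ltac:(auto) ltac:(auto) ltac:(auto).
by rewrite leNgt -ltrBlDl s1.
Qed.

Lemma hoelderMn x n : C x -> hoelder (x *+ n) = n%:R * hoelder x.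
Proof.
move=> Cx; elim: n => [|n IHn].
  have := hoelderD C0 C0; rewrite mulr0n addr0 mul0r; lra.
by rewrite mulrS hoelderD ?IHn ?mulrS; auto; ring.
Qed.

Lemma hoelder_unit : hoelder e = 1.
Proof.
have ee : le e e by apply: ap_refl.
apply/le_anti/andP; split.
  have := @hoelder_upper e 1 0 1 Ce isT; rewrite mulr0n addr0 mulr1n subr0 divr1.
  exact.
have := @hoelder_lower e 1 0 1 Ce isT; rewrite mulr0n addr0 mulr1n subr0 divr1.
exact.
Qed.

Lemma hoelder_homo x y : C x -> C y -> le x y -> hoelder x <= hoelder y.
Proof.
move=> Cx Cy xy; rewrite leNgt; apply/negP => /ratio_between.
move=> [p [q [m /andP[yr rx]]]].
have lo := lt_hoelder Cx (ltn0Sn m) rx.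
suff /(hoelder_lower Cy (ltn0Sn m)) : le (e *+ p) (y *+ m.+1 + e *+ q).
  by rewrite leNgt yr.
apply: (ap_trans ap _ _ _ lo); auto.
by apply/(ap_add ap); auto; apply: ap_leMn.
Qed.

Lemma le_hoelder x y : C x -> C y -> le x y <-> hoelder x <= hoelder y.
Proof.
move=> Cx Cy; split; first exact: hoelder_homo.
move=> fxy; apply: contrapT => /(ap_arch ap Cx Cy) [n /hoelder_homo].
rewrite hoelderD ?hoelderMn ?hoelder_unit; auto => h.
have := h ltac:(auto) ltac:(auto); have := ler_wpM2l (ler0n R n) fxy; lra.
Qed.

(** Every comparison of [m x + q e] with [p e] is transported by [psi], so that
    [psi x] and [psi e * hoelder x] define the same cut. *)
Lemma hoelder_unique (psi : M -> R) :
  (forall x y, C x -> C y -> psi (x + y) = psi x + psi y) ->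
  (forall x y, C x -> C y -> le x y -> psi x <= psi y) ->
  forall x, C x -> psi x = psi e * hoelder x.
Proof.
move=> psiD psi_homo x Cx.
have psi0 : psi 0 = 0 by have := psiD _ _ C0 C0; rewrite addr0; lra.
have psiMn y n : C y -> psi (y *+ n) = n%:R * psi y.
  move=> Cy; elim: n => [|n IHn]; first by rewrite mulr0n psi0 mul0r.
  by rewrite mulrS psiD ?IHn ?mulrS; auto; ring.
have c0 : 0 <= psi e.
  rewrite -psi0; apply: psi_homo; auto.
  by have [|/(ap_pos ap)] := ap_total ap C0 Ce.
have psi_lo p q m : le (e *+ p) (x *+ m + e *+ q) ->
    (p%:R - q%:R) * psi e <= m%:R * psi x.
  move/psi_homo; rewrite psiD ?psiMn; auto => h.
  by have := h ltac:(auto) ltac:(auto); lra.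
have psi_up p q m : le (x *+ m + e *+ q) (e *+ p) ->
    m%:R * psi x <= (p%:R - q%:R) * psi e.
  move/psi_homo; rewrite psiD ?psiMn; auto => h.
  by have := h ltac:(auto) ltac:(auto); lra.
have [e0|en0] := eqVneq (psi e) 0.
  have [n [xn nx]] := ap_bound ap Cx; rewrite e0 mul0r.
  have := psi_up n 0%N 1%N; have := psi_lo 0%N n 1%N.
  rewrite e0 !mulr0 mul1r mulr1n mulr0n addr0 => /(_ nx) ? /(_ xn) ?.
  exact/le_anti/andP.
have {en0}c0 : 0 < psi e by rewrite lt_neqAle eq_sym en0.
apply/le_anti/andP; split; rewrite leNgt; apply/negP.
  rewrite mulrC -ltr_pdivlMr // => /ratio_between [p [q [m /andP[r1 r2]]]].
  have := psi_up p q m.+1 (gt_hoelder Cx (ltn0Sn m) r1).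
  rewrite leNgt => /negP; apply.
  by move: r2; rewrite ltr_pdivrMr ?ltr0n // mulrAC ltr_pdivlMr // [psi x * _]mulrC.
rewrite mulrC -ltr_pdivrMr // => /ratio_between [p [q [m /andP[r1 r2]]]].
have := psi_lo p q m.+1 (lt_hoelder Cx (ltn0Sn m) r2).
rewrite leNgt => /negP; apply.
by move: r1; rewrite ltr_pdivlMr ?ltr0n // mulrAC ltr_pdivrMr // [psi x * _]mulrC.
Qed.

End Hoelder.

(** * Preordered semifields *)

Arguments psf_le_trans {s} {x y z}.
Arguments psf_add_mono {s} a {x y}.
Arguments psf_mul_mono {s} a {x y}.

Section Semifield.
Variable F : semifieldType.
Implicit Types x y : F.

Lemma semifield_one_neq0 : 1 <> 0 :> F.
Proof. by apply/semifield_invertible; exists 1; rewrite mulr1. Qed.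

Lemma semifield_mulf_neq0 x y : x <> 0 -> y <> 0 -> x * y <> 0.
Proof.
move=> x0 y0; apply/semifield_invertible; exists (sinv y * sinv x).
by rewrite mulrA -(mulrA x) mulf_sinv // mulr1 mulf_sinv.
Qed.

Lemma sinv_neq0 x : x <> 0 -> sinv x <> 0.
Proof.
move=> x0; apply/semifield_invertible; exists x.
by rewrite mulrC mulf_sinv.
Qed.

Lemma semifield_expf_neq0 x n : x <> 0 -> x ^+ n <> 0.
Proof.
move=> x0; elim: n => [|n IHn]; first exact: semifield_one_neq0.
by rewrite exprS; apply: semifield_mulf_neq0.
Qed.

End Semifield.

(** [F] with its multiplication as additive law, so that [n] times [x] is the power
    [x ^+ n]; zero is excluded later by the domain predicate. *)
Definition multiplicative (F : semifieldType) : Type := F.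
HB.instance Definition _ (F : semifieldType) := Choice.on (multiplicative F).
HB.instance Definition _ (F : semifieldType) :=
  GRing.isNmodule.Build (multiplicative F) (@mulrA F) (@mulrC F) (@mul1r F).

Lemma multiplicative_mulrn (F : semifieldType) (x : F) n :
  (x : multiplicative F) *+ n = x ^+ n.
Proof. by elim: n => [//|n IHn]; rewrite mulrS exprS IHn. Qed.

Lemma rmorphism_exists (A B : pzSemiRingType) (f : A -> B) :
  f 0 = 0 -> (forall x y, f (x + y) = f x + f y) ->
  f 1 = 1 -> (forall x y, f (x * y) = f x * f y) ->
  exists g : {rmorphism A -> B}, g =1 f.
Proof.
move=> f0 fD f1 fM.
pose fA := GRing.isNmodMorphism.Build A B f (conj f0 fD).
pose fX := GRing.isMonoidMorphism.Build A B f (conj f1 fM).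
by exists (HB.pack f fA fX : {rmorphism A -> B}).
Qed.

Section Preorder.
Variable F : preorderedSemifieldType.
Implicit Types c g h x y z w : F.

Lemma psf_leD x y z w : x <=p y -> z <=p w -> x + z <=p y + w.
Proof.
move=> xy zw; apply: psf_le_trans (psf_add_mono x zw) _.
by rewrite ![_ + w]addrC; apply: psf_add_mono.
Qed.

Lemma psf_leM x y z w : x <=p y -> z <=p w -> x * z <=p y * w.
Proof.
move=> xy zw; apply: psf_le_trans (psf_mul_mono x zw) _.
by rewrite ![_ * w]mulrC; apply: psf_mul_mono.
Qed.

Lemma psf_leX x y n : x <=p y -> x ^+ n <=p y ^+ n.
Proof.
move=> xy; elim: n => [|n IHn]; first exact: psf_le_refl.
by rewrite !exprS; apply: psf_leM.
Qed.

(** Leaves two semiring identities, so that [ring] bridges the gap between a proved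
    inequality and the goal. *)
Lemma psf_le_eq x y z w : x <=p y -> x = z -> y = w -> z <=p w.
Proof. by move=> + <- <-. Qed.

Lemma psf_le_mul2l c x y : c <> 0 -> c * x <=p c * y -> x <=p y.
Proof.
move=> c0 /(psf_mul_mono (sinv c)).
by rewrite !mulrA [sinv c * c]mulrC mulf_sinv // !mul1r.
Qed.

Lemma sim_refl x : sim x x.
Proof. exact: rst_refl. Qed.

Lemma sim_sym x y : sim x y -> sim y x.
Proof. exact: rst_sym. Qed.

Lemma sim_trans x y z : sim x y -> sim y z -> sim x z.
Proof. exact: rst_trans. Qed.

Lemma sim_le x y : x <=p y -> sim x y.
Proof. exact: rst_step. Qed.

(** The group acting on each class of [~]: all comparisons between nonzero
    elements reduce to comparisons inside it. *)
Definition sim1 g : Prop := g <> 0 /\ sim g 1.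

Lemma sim1_1 : sim1 1.
Proof. by split; [exact: semifield_one_neq0 | exact: sim_refl]. Qed.

Lemma sim1M g h : sim1 g -> sim1 h -> sim1 (g * h).
Proof.
move=> [g0 g1] [h0 h1]; split; first exact: semifield_mulf_neq0.
by have := sim_mul g1 h1; rewrite mulr1.
Qed.

Lemma sim1X g n : sim1 g -> sim1 (g ^+ n).
Proof.
move=> Gg; elim: n => [|n IHn]; first exact: sim1_1.
by rewrite exprS; apply: sim1M.
Qed.

Lemma sim1_divE x y : x <> 0 -> y <> 0 -> sim x y ->
  exists2 g, sim1 g & x = y * g.
Proof.
move=> x0 y0 xy; exists (x * sinv y); last first.
  by rewrite mulrCA mulf_sinv // mulr1.
split; first exact/semifield_mulf_neq0/sinv_neq0.
by have := sim_mull (sinv y) xy; rewrite [sinv y * y]mulrC mulf_sinv // mulrC.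
Qed.

Lemma sim1V g : sim1 g -> exists2 h, sim1 h & g * h = 1.
Proof.
move=> [g0 g1]; have [h Gh ->] := sim1_divE (@semifield_one_neq0 F) g0 (sim_sym g1).
by exists h.
Qed.

Lemma inv_nle1 g h : g * h = 1 -> ~ g <=p 1 -> ~ 1 <=p h.
Proof.
move=> gh g1 h1; apply: g1; apply: psf_le_eq (psf_mul_mono g h1) _ _ => //.
by rewrite mulr1.
Qed.

Lemma inv_nge1 g h : g * h = 1 -> ~ 1 <=p g -> ~ h <=p 1.
Proof.
move=> gh g1 h1; apply: g1; apply: psf_le_eq (psf_mul_mono g h1) _ _ => //.
by rewrite mulr1.
Qed.

Lemma sim1_sim g h : sim1 g -> sim1 h -> sim g h.
Proof. by move=> [_ g1] [_ h1]; apply: sim_trans g1 (sim_sym h1). Qed.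

Lemma sim_sim1Ml g x : sim1 g -> sim (g * x) x.
Proof. by move=> [_ g1]; have := sim_mul g1 (sim_refl x); rewrite mul1r. Qed.

End Preorder.

(** * Consequences of fullness, the Archimedean property and quasi-complements *)

Section FullyPreordered.
Variables (F : preorderedSemifieldType) (u : F).
Hypotheses (hF : fully_preordered F) (hA : mult_archimedean F).
Hypotheses (hu0 : u <> 0) (hu : 1 <p u).
Hypothesis square_ge0 : forall g : F, sim1 g -> 2 * g <=p 1 + g * g.
Implicit Types a b c d g h q r s t w x y z : F.

Lemma sim1_u : sim1 u.
Proof. by split=> //; apply/sim_sym/sim_le; case: hu. Qed.

Lemma sim1_total g h : sim1 g -> sim1 h -> g <=p h \/ h <=p g.
Proof. by move=> Gg Gh; apply/hF/sim1_sim. Qed.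

Lemma sim1_nle g h : sim1 g -> sim1 h -> ~ g <=p h -> h <=p g.
Proof. by move=> Gg Gh; case: (sim1_total Gg Gh). Qed.

(** A semifield with an additive inverse is a ring, and there adding [- (x + y)] to
    [x <= y] reverses it; this is incompatible with [1 < u]. *)
Lemma addf_eq0 x y : x + y = 0 -> x = 0.
Proof.
move=> xy0; apply: contrapT => x0; case: hu => [u1 []].
have [n n0] : exists n : F, 1 + n = 0.
  by exists (sinv x * y); rewrite -(mulf_sinv x0) [x * _]mulrC -mulrDr xy0 mulr0.
apply: (psf_le_eq (psf_leD (psf_mul_mono n u1) (psf_le_refl (1 + u)))).
  by rewrite mulr1 addrA [_ + 1]addrC n0 add0r.
by have -> : n * u + (1 + u) = 1 + u * (1 + n); [ring | rewrite n0 mulr0 addr0].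
Qed.

Lemma addf_neq0 x y : x <> 0 -> x + y <> 0.
Proof. by move=> x0 /addf_eq0. Qed.

Lemma natrS_neq0 n : n.+1%:R <> 0 :> F.
Proof. by rewrite mulrS; apply/addf_neq0/semifield_one_neq0. Qed.
Local Hint Resolve natrS_neq0 : core.

Lemma sim1_mean n g : sim1 g ->
  exists2 k, sim1 k & n%:R + g = n.+1%:R * k.
Proof.
move=> [g0 g1]; apply: sim1_divE => //; first by rewrite addrC; apply: addf_neq0.
by rewrite mulrSr; apply: sim_addl.
Qed.

Lemma sim1_arch r y : sim1 r -> ~ r <=p 1 -> sim1 y ->
  exists k, y <=p r ^+ k.
Proof.
move=> Gr r1 Gy; apply: contrapT => nex; apply: r1.
case: (Gr) (Gy) => [r0 _] [y0 _]; apply: (hA r0 y0) => k.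
apply: sim1_nle => //; first exact: sim1X.
by move=> yr; apply: nex; exists k.
Qed.

(** If [1 <= 0] then [g * g <= 0], so [2 g <= 1 + g * g] bounds all powers of [u] by
    the inverse of 2. *)
Lemma one_nle0 : ~ (1 : F) <=p 0.
Proof.
move=> le10; case: hu => _; apply.
have le0 x : x <=p 0 by have := psf_mul_mono x le10; rewrite mulr1 mulr0.
apply: (hA hu0 (sinv_neq0 (@natrS_neq0 1))) => k.
apply: (psf_le_mul2l (@natrS_neq0 1)); rewrite mulf_sinv //.
apply: psf_le_trans (square_ge0 (sim1X k sim1_u)) _.
by have := psf_leD (psf_le_refl 1) (le0 (u ^+ k * u ^+ k)); rewrite addr0.
Qed.

Lemma psf_nle0 x : x <> 0 -> ~ x <=p 0.
Proof.
move=> x0 /(psf_mul_mono (sinv x)); rewrite mulrC mulf_sinv // mulr0.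
exact: one_nle0.
Qed.

Lemma sim_ge0 x : sim 0 x -> 0 <=p x.
Proof.
move=> /hF[//|x0]; have [-> |] := EM (x = 0); first exact: psf_le_refl.
by move/psf_nle0.
Qed.

Hypothesis hquasi : quasi_complements (sim_quot F).

Lemma pi_natr n : \pi_(sim_quot F)%qT n%:R = n%:R :> sim_quot F.
Proof.
elim: n => [//|n IHn]; rewrite !mulrS -IHn.
exact/esym/sq_addE.
Qed.

(** Quasi-complements in the form in which they are used: adding [z] turns any
    element into a positive multiple of a group element.  The extra summand 1
    in the witness guarantees a nonzero sum and a nonzero multiplicity. *)
Lemma complement x : exists z n h, sim1 h /\ x + z = n.+1%:R * h.
Proof.
have [a [n]] := hquasi (\pi_(sim_quot F)%qT x).
have [z ->] := sq_surj a; rewrite -pi_natr => xzn.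
have {}xzn : sim (x + z) n%:R.
  apply/asboolP; rewrite -[`[< _ >]]/(simb _ _) -(eqquotE (sim_quot F)).
  by rewrite -xzn; apply/eqP/esym/sq_addE.
exists (z + 1), n.
have [h Gh ->] : exists2 h, sim1 h & x + (z + 1) = n.+1%:R * h; last by exists h.
apply: sim1_divE => //.
  rewrite addrA addrC; exact/addf_neq0/semifield_one_neq0.
by rewrite addrA mulrSr; apply: sim_add xzn _; exact: sim_refl.
Qed.

(** * The max-tropical case *)

Section Tropical.
Hypothesis tropical : forall g : F, sim1 g -> 1 <=p g -> 2 * g <=p 1 + g.

(** In the representation this says [phi z <= phi x]. *)
Definition absorbs x z : Prop :=
  forall d, sim1 d -> d <=p 1 -> x + z <=p x + d * z.

Lemma tropical_le1 g : sim1 g -> g <=p 1 -> 2 <=p 1 + g.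
Proof.
move=> Gg g1; have [h Gh gh1] := sim1V Gg.
have h1 : 1 <=p h.
  by apply: psf_le_eq (psf_mul_mono h g1) _ _; rewrite ?mulr1 // mulrC.
apply: psf_le_eq (psf_mul_mono g (tropical Gh h1)) _ _.
  by rewrite mulrCA gh1 mulr1.
by rewrite mulrDr mulr1 gh1 addrC.
Qed.

Lemma absorbs_refl x : absorbs x x.
Proof.
move=> d Gd d1; apply: psf_le_eq (psf_mul_mono x (tropical_le1 Gd d1)) _ _; ring.
Qed.

Lemma absorbsMl c x z : absorbs x z -> absorbs (c * x) (c * z).
Proof.
move=> xz d Gd d1; apply: psf_le_eq (psf_mul_mono c (xz d Gd d1)) _ _; ring.
Qed.

Lemma absorbs_mul2l c x z : c <> 0 -> absorbs (c * x) (c * z) -> absorbs x z.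
Proof.
move=> c0 h d Gd d1; apply: (psf_le_mul2l c0).
apply: psf_le_eq (h d Gd d1) _ _; ring.
Qed.

Lemma absorbsDr x z w : absorbs x z -> absorbs x w -> absorbs x (z + w).
Proof.
move=> xz xw d Gd d1.
apply: psf_le_trans (_ : x + d * z + w <=p _).
  by apply: psf_le_eq (psf_add_mono w (xz d Gd d1)) _ _; ring.
by apply: psf_le_eq (psf_add_mono (d * z) (xw d Gd d1)) _ _; ring.
Qed.

Lemma absorbsDl x y z : absorbs x z -> absorbs (x + y) z.
Proof.
move=> xz d Gd d1; apply: psf_le_eq (psf_add_mono y (xz d Gd d1)) _ _; ring.
Qed.

(** If both absorptions fail, at [d] and [e], then [p = x + d z] and
    [q = z + e x] are both strictly below [x + z].  They are comparable, and the
    larger one is at least [x + z]: indeed [p + q] is at least [2 (x + z)],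
    because [1 + d] and [1 + e] are at least 2. *)
Lemma absorbs_total x z : x <> 0 -> absorbs x z \/ absorbs z x.
Proof.
move=> x0; apply: contrapT => /not_orP[nxz nzx].
have [d [Gd d1 nd]] : exists d, [/\ sim1 d, d <=p 1 & ~ x + z <=p x + d * z].
  apply: contrapT => h; apply: nxz => d Gd d1; apply: contrapT => nd.
  by apply: h; exists d.
have [e [Ge e1 ne]] : exists e, [/\ sim1 e, e <=p 1 & ~ z + x <=p z + e * x].
  apply: contrapT => h; apply: nzx => e Ge e1; apply: contrapT => ne.
  by apply: h; exists e.
have pq : 2 * (x + z) <=p (x + d * z) + (z + e * x).
  apply: psf_le_eq (psf_leD (psf_mul_mono x (tropical_le1 Ge e1))
    (psf_mul_mono z (tropical_le1 Gd d1))) _ _; ring.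
have : sim (x + d * z) (z + e * x).
  apply: (sim_trans (sim_addl x (sim_sim1Ml z Gd))).
  by rewrite addrC; apply/sim_addl/sim_sym/sim_sim1Ml.
move=> /hF[] le; [apply: ne | apply: nd]; apply: (psf_le_mul2l (@natrS_neq0 1)).
  apply: psf_le_trans (_ : (z + e * x) + (z + e * x) <=p _).
    rewrite [z + x]addrC; apply: psf_le_trans pq _.
    by apply: psf_leD le (psf_le_refl _).
  by apply: psf_le_eq (psf_le_refl (2 * (z + e * x))) _ _; ring.
apply: psf_le_trans pq _.
by apply: psf_le_eq (psf_add_mono (x + d * z) le) _ _; ring.
Qed.

(** If [y + z = w r] with [w = y + d z] and [r > 1], then adding [x] makes the
    factor [r] invisible, as [x] absorbs [z]; but it also makes it visible, as [y]
    absorbs [x] and so [r w + x] is as large as [r (w + x)]. *)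
Lemma absorbs_trans x y z : y <> 0 -> absorbs y x -> absorbs x z -> absorbs y z.
Proof.
move=> y0 yx xz d Gd d1; apply: contrapT => nle.
have w0 : y + d * z <> 0 by apply: addf_neq0.
have [r Gr Er] : exists2 r, sim1 r & y + z = (y + d * z) * r.
  apply: sim1_divE => //; first exact: addf_neq0.
  exact/sim_addl/sim_sym/sim_sim1Ml.
have r1 : ~ r <=p 1.
  by move=> /(psf_mul_mono (y + d * z)); rewrite -Er mulr1.
have [s Gs rs1] := sim1V Gr.
have s1 : s <=p 1.
  apply: psf_le_eq (psf_mul_mono s (sim1_nle Gr (sim1_1 F) r1)) _ _.
    by rewrite mulr1.
  by rewrite mulrC.
apply: r1; apply: (@psf_le_mul2l _ (y + d * z + x)); first exact: addf_neq0.
apply: psf_le_trans (_ : y + z + x <=p _).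
  rewrite Er; apply: psf_le_eq (psf_leD (psf_mul_mono r (yx s Gs s1))
    (psf_le_refl (r * d * z))) _ _; first by ring.
  by rewrite mulrDr mulrA rs1; ring.
by apply: psf_le_eq (psf_add_mono y (xz d Gd d1)) _ _; ring.
Qed.

Lemma absorbs_sim x z : x <> 0 -> z <> 0 -> sim z x -> absorbs x z <-> z <=p x.
Proof.
move=> x0 z0 /(sim1_divE z0 x0)[g Gg ->].
have [h Gh gh1] := sim1V Gg; split=> [xz|xgx d Gd d1].
  apply: contrapT => ngx; have g1 : ~ g <=p 1.
    by move/(psf_mul_mono x); rewrite mulr1.
  have {}g1 := sim1_nle Gg (sim1_1 F) g1.
  apply: ngx; apply: (psf_le_mul2l (@natrS_neq0 1)).
  apply: psf_le_trans (_ : x + x * g <=p _).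
    by apply: psf_le_eq (psf_mul_mono x (tropical Gg g1)) _ _; ring.
  have h1 : h <=p 1.
    by apply: psf_le_eq (psf_mul_mono h g1) _ _; rewrite ?mulr1 // mulrC.
  apply: psf_le_eq (xz h Gh h1) _ _ => //.
  rewrite mulrCA [h * g]mulrC gh1; ring.
have g1 : g <=p 1 by apply: (psf_le_mul2l x0); rewrite mulr1.
have dg1 : d * g <=p 1 by have := psf_leM d1 g1; rewrite mulr1.
apply: psf_le_trans (_ : 2 * x <=p _).
  by apply: psf_le_eq (psf_mul_mono x (psf_add_mono 1 g1)) _ _; ring.
apply: psf_le_eq (psf_mul_mono x (tropical_le1 (sim1M Gd Gg) dg1)) _ _; ring.
Qed.

Lemma absorbs_bound x : x <> 0 -> exists k, absorbs (u ^+ k) x.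
Proof.
move=> x0; have [z [n [h [Gh xz]]]] := complement x.
have [k hk] := sim1_arch sim1_u hu.2 Gh.
have uk0 := @semifield_expf_neq0 _ _ k hu0.
exists k; apply: (absorbs_trans uk0 (x := h)); last first.
  apply: (absorbs_trans Gh.1 (x := n.+1%:R * h)).
    elim: (n) => [|m IHm]; first by rewrite mul1r; apply: absorbs_refl.
    by rewrite mulrS mulrDl mul1r; apply: absorbsDr => //; apply: absorbs_refl.
  by rewrite -xz; apply/absorbsDl/absorbs_refl.
apply/absorbs_sim => //; first exact: Gh.1.
exact/sim1_sim/sim1X/sim1_u.
Qed.

(** If [1] does not absorb [z], then [1 + z = (1 + d z) r] with [r > 1], and
    [(1 + z) ^ n] is at least of the size [r ^ n].  All monomials in its
    expansion are absorbed by [u], so [r ^ n <= u] for all [n]. *)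
Lemma absorbs_arch z : z <> 0 -> (forall n, absorbs u (z ^+ n)) -> absorbs 1 z.
Proof.
move=> z0 uz d Gd d1; apply: contrapT => nle.
have [r Gr Er] : exists2 r, sim1 r & 1 + z = (1 + d * z) * r.
  apply: sim1_divE; try exact/addf_neq0/semifield_one_neq0.
  exact/sim_addl/sim_sym/sim_sim1Ml.
have r1 : ~ r <=p 1.
  by move=> /(psf_mul_mono (1 + d * z)); rewrite -Er mulr1.
apply: r1; apply: (hA Gr.1 hu0) => n; have rn0 := @semifield_expf_neq0 _ _ n Gr.1.
apply/absorbs_sim => //; first exact: sim1_sim (sim1X n Gr) sim1_u.
(* The factor [z ^+ m] makes the induction on [n] go through. *)
have big m : absorbs u (z ^+ m * (1 + z) ^+ n).
  elim: n m {rn0} => [|n IHn] m; first by rewrite mulr1.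
  rewrite exprS (_ : _ * _ = z ^+ m * (1 + z) ^+ n + z ^+ m.+1 * (1 + z) ^+ n).
    exact: absorbsDr.
  by rewrite exprS; ring.
have small k : absorbs ((1 + d * z) ^+ k) 1.
  elim: k => [|k IHk]; first exact: absorbs_refl.
  by rewrite exprS mulrDl mul1r; apply: absorbsDl.
apply: (absorbs_trans hu0 (x := (1 + z) ^+ n)).
  by have := big 0%N; rewrite mul1r.
rewrite Er exprMn mulrC -[X in absorbs _ X]mulr1.
exact: absorbsMl.
Qed.

Lemma absorbs_archimedean_preorder :
  @archimedean_preorder (multiplicative F) (fun x => x <> 0 :> F)
    (fun x y => absorbs y x) u.
Proof.
have G1 : 1 <> 0 :> F by apply: semifield_one_neq0.
split=> //.
- exact: semifield_mulf_neq0.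
- by move=> x y z x0 y0 z0 xy yz; apply: absorbs_trans yz xy.
- by move=> x y x0 y0; apply: absorbs_total.
- move=> x y z x0 y0 z0; rewrite ![(_ : multiplicative F) + z]addrC.
  by split; [apply: absorbs_mul2l | apply: absorbsMl].
- by move=> abs; apply: hu.2; apply/(absorbs_sim G1 hu0 sim1_u.2).
- move=> x x0; have [k ukx] := absorbs_bound x0.
  have [l ulx] := absorbs_bound (sinv_neq0 x0).
  have up m : (m <= k + l)%N -> absorbs (u ^+ (k + l)) (u ^+ m).
    move=> le; apply/absorbs_sim; try exact: semifield_expf_neq0.
      by apply: sim1_sim; apply/sim1X/sim1_u.
    rewrite -(subnKC le) exprD -[X in X <=p _]mulr1; apply: psf_mul_mono.
    by have := psf_leX (k + l - m) hu.1; rewrite expr1n.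
  have nz := @semifield_expf_neq0 F.
  exists (k + l)%N; rewrite multiplicative_mulrn; split.
    apply: (absorbs_trans _ _ ukx); first exact: nz.
    exact/up/leq_addr.
  apply: (absorbs_mul2l (sinv_neq0 x0)).
  rewrite [X in absorbs X _]mulrA [sinv x * x]mulrC mulf_sinv // mul1r.
  rewrite [X in absorbs _ X]mulr1.
  apply: (absorbs_trans _ _ ulx); first exact: nz.
  exact/up/leq_addl.
- move=> x y x0 y0 nyx; apply: contrapT => nex; apply: nyx.
  have xyn n : absorbs u ((sinv y * x) ^+ n).
    have yn0 := @semifield_expf_neq0 _ _ n y0.
    apply: (absorbs_mul2l yn0); rewrite exprMn mulrA -exprMn mulf_sinv //.
    rewrite expr1n mul1r.
    have [//|xy] := @absorbs_total (y ^+ n * u) (x ^+ n)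
      (semifield_mulf_neq0 yn0 hu0).
    by case: nex; exists n; rewrite !multiplicative_mulrn.
  have z0 : sinv y * x <> 0 by apply: semifield_mulf_neq0 x0; apply: sinv_neq0.
  have := @absorbsMl y _ _ (absorbs_arch z0 xyn).
  by rewrite mulr1 mulrA mulf_sinv // mul1r.
Qed.

Variable R : realType.

Let f := @hoelder R (multiplicative F) (fun x y => absorbs y x) u.

Let phi (x : F) : R := if `[< x = 0 >] then 0 else expR (f x).

Let phi_ge0 x : 0 <= phi x.
Proof. by rewrite /phi; case: asboolP => // _; exact: expR_ge0. Qed.

Let phiE x : x <> 0 -> phi x = expR (f x).
Proof. by rewrite /phi; case: asboolP. Qed.

Let phi0 : phi 0 = 0.
Proof. by rewrite /phi; case: asboolP. Qed.

Let ap := absorbs_archimedean_preorder.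

Let le_phi x z : x <> 0 -> z <> 0 -> phi z <= phi x <-> absorbs x z.
Proof.
move=> x0 z0; rewrite (phiE x0) (phiE z0) ler_expR; apply: iff_sym.
exact: (le_hoelder R ap z0 x0).
Qed.

Let phiM x z : phi (x * z) = phi x * phi z.
Proof.
have [->|x0] := EM (x = 0); first by rewrite mul0r phi0 mul0r.
have [->|z0] := EM (z = 0); first by rewrite mulr0 phi0 mulr0.
rewrite !phiE //; last exact: semifield_mulf_neq0.
by rewrite -expRD; congr expR; apply: (hoelderD R ap x0 z0).
Qed.

Let phi1 : phi 1 = 1.
Proof.
rewrite phiE; last exact: semifield_one_neq0.
by have := hoelderMn R ap 0 hu0; rewrite mulr0n mul0r -/f => ->; rewrite expR0.
Qed.

Let phiD x z : phi (x + z) = Num.max (phi x) (phi z).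
Proof.
have [->|x0] := EM (x = 0); first by rewrite add0r phi0 max_r.
have [->|z0] := EM (z = 0); first by rewrite addr0 phi0 max_l.
wlog xz : x z x0 z0 / absorbs x z => [wl|].
  have [xz|zx] := absorbs_total z x0; first exact: wl.
  by rewrite addrC maxC; apply: wl.
have xz0 : x + z <> 0 by apply: addf_neq0.
rewrite max_l; last exact/le_phi.
apply/le_anti/andP; split; apply/le_phi => //.
  by apply: absorbsDr => //; apply: absorbs_refl.
exact/absorbsDl/absorbs_refl.
Qed.

Theorem tropical_representation : exists phi : {rmorphism F -> TRplus R},
  forall x y, sim x y -> (x <=p y <-> phi x <=p phi y).
Proof.
pose psi x : TRplus R := MkTRplus (phi_ge0 x).
have [||||g gE] := @rmorphism_exists F (TRplus R) psi.
- exact/val_inj/phi0.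
- by move=> x z; apply/val_inj/phiD.
- exact/val_inj/phi1.
- by move=> x z; apply/val_inj/phiM.
exists g => x y xy; rewrite !gE.
change (x <=p y <-> phi x <= phi y).
have [x0|x0] := EM (x = 0).
  by rewrite x0 phi0 phi_ge0; split=> // _; apply: sim_ge0; rewrite -x0.
have [y0|y0] := EM (y = 0).
  rewrite y0 phi0; split; first by move/(psf_nle0 x0).
  by rewrite phiE // leNgt expR_gt0.
by apply: iff_trans (iff_sym (absorbs_sim y0 x0 xy)) (iff_sym (le_phi y0 x0)).
Qed.

End Tropical.

(** * The max-temperate case *)

Section Temperate.
Hypothesis temperate :
  forall g : F, sim1 g -> ~ g <=p 1 -> ~ 2 * g <=p 1 + g.
Hypothesis square_gt0 :
  forall g : F, sim1 g -> ~ g <=p 1 -> ~ 1 + g * g <=p 2 * g.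

(** Reason: [4 g <= (1 + g) ^ 2], so the mean of 1 and [g] exceeds 1 when [g] does. *)
Lemma half_gt1 g : sim1 g -> ~ g <=p 1 ->
  exists q, [/\ sim1 q, ~ q <=p 1 & 1 + g = 2 * q].
Proof.
move=> Gg g1; have [q Gq Eq] := sim1_mean 1 Gg; exists q; split=> //.
move=> q1; apply: g1; apply: (psf_le_mul2l (@natrS_neq0 3)).
have q2 := psf_leM (psf_mul_mono 2 q1) (psf_mul_mono 2 q1).
apply: psf_le_trans (_ : (2 * q) * (2 * q) <=p _); last first.
  by apply: psf_le_eq q2 _ _ => //; ring.
rewrite -Eq; apply: psf_le_eq (psf_add_mono (2 * g) (square_ge0 Gg)) _ _; ring.
Qed.

Lemma half_lt1 g : sim1 g -> ~ 1 <=p g ->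
  exists q, [/\ sim1 q, ~ 1 <=p q & 1 + g = 2 * q].
Proof.
move=> Gg g1; have [q Gq Eq] := sim1_mean 1 Gg; exists q; split=> //.
have [h Gh gh] := sim1V Gg.
move=> q1; apply: (temperate Gh (inv_nge1 gh g1)).
apply: psf_le_eq (psf_mul_mono h (psf_mul_mono 2 q1)) _ _; first by ring.
by rewrite -Eq mulrDr mulr1 [h * g]mulrC gh addrC.
Qed.

(** Repeated averaging with 1 never loses strictness. *)
Lemma mean_gt1 n m g : sim1 g -> ~ g <=p 1 ->
  exists q, [/\ sim1 q, ~ q <=p 1 &
    (n + m.+1)%:R * q <=p n%:R + m.+1%:R * g].
Proof.
move=> Gg g1; elim: n => [|n [q [Gq q1 le]]].
  by exists g; rewrite add0r; split=> //; apply: psf_le_refl.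
have [q' [Gq' q'1 Eq]] := half_gt1 Gq q1; exists q'; split=> //.
have q'q : q' <=p q.
  apply: (psf_le_mul2l (@natrS_neq0 1)); rewrite -Eq.
  apply: psf_le_eq (psf_add_mono q (sim1_nle Gq (sim1_1 F) q1)) _ _; ring.
apply: psf_le_trans (_ : 1 + (n + m.+1)%:R * q <=p _).
  apply: psf_le_eq (psf_add_mono (2 * q') (psf_mul_mono (n + m)%:R q'q)) _ _.
    by rewrite addSnnS addnS natrD; ring.
  by rewrite -Eq addnS mulrS; ring.
by apply: psf_le_eq (psf_add_mono 1 le) _ _ => //; rewrite mulrS; ring.
Qed.

Lemma mean_lt1 n m g : sim1 g -> ~ 1 <=p g ->
  exists q, [/\ sim1 q, ~ 1 <=p q &
    n%:R + m.+1%:R * g <=p (n + m.+1)%:R * q].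
Proof.
move=> Gg g1; elim: n => [|n [q [Gq q1 le]]].
  by exists g; rewrite add0r; split=> //; apply: psf_le_refl.
have [q' [Gq' q'1 Eq]] := half_lt1 Gq q1; exists q'; split=> //.
have qq' : q <=p q'.
  apply: (psf_le_mul2l (@natrS_neq0 1)); rewrite -Eq.
  apply: psf_le_eq (psf_add_mono q (sim1_nle (sim1_1 F) Gq q1)) _ _; ring.
apply: psf_le_trans (_ : 1 + (n + m.+1)%:R * q <=p _).
  by apply: psf_le_eq (psf_add_mono 1 le) _ _ => //; rewrite mulrS; ring.
apply: psf_le_eq (psf_add_mono (2 * q') (psf_mul_mono (n + m)%:R qq')) _ _.
  by rewrite -Eq addnS mulrS; ring.
by rewrite addSnnS addnS natrD; ring.
Qed.

Lemma sum_inv_ge2 g h : sim1 g -> g * h = 1 -> 2 <=p g + h.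
Proof.
move=> Gg gh; apply: psf_le_eq (psf_mul_mono h (square_ge0 Gg)) _ _.
  by rewrite mulrCA [h * g]mulrC gh mulr1.
by rewrite mulrDr mulr1 mulrA [h * g]mulrC gh mul1r addrC.
Qed.

(** The function [s |-> s + c] is log-convex, as
    [(a + c) ^ 2 <= (g a + c) (a / g + c)] by [2 <= g + 1 / g].  A log-convex
    nondecreasing function that is constant on one interval is constant to the
    left of it. *)
Lemma flat_left c g : sim1 g -> ~ g <=p 1 -> g + c <=p 1 + c ->
  forall s, sim1 s -> s <=p 1 -> 1 + c <=p s + c.
Proof.
move=> Gg g1 gc s Gs s1; have [h Gh gh] := sim1V Gg.
have [s' Gs' ss'] := sim1V Gs; have [k s'k] := sim1_arch Gg g1 Gs'.
have hs : h ^+ k <=p s.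
  have ghk : g ^+ k * h ^+ k = 1 by rewrite -exprMn gh expr1n.
  apply: psf_le_eq (psf_mul_mono (s * h ^+ k) s'k) _ _.
    by rewrite mulrAC ss' mul1r.
  by rewrite -mulrA [h ^+ k * _]mulrC ghk mulr1.
apply: psf_le_trans (_ : h ^+ k + c <=p _); last first.
  by rewrite ![_ + c]addrC; apply: psf_add_mono.
suff [] : g * h ^+ k + c <=p h ^+ k + c /\ 1 + c <=p h ^+ k + c by [].
elim: k {s'k hs} => [|k [IH1 IH2]]; first by rewrite mulr1; split=> //; exact: psf_le_refl.
set a := h ^+ k in IH1 IH2 *; rewrite exprS mulrA gh mul1r -/a.
suff le : a + c <=p h * a + c by split=> //; apply: psf_le_trans le.
apply: (@psf_le_mul2l _ (a + c)); first exact/addf_neq0/semifield_expf_neq0/Gh.1.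
apply: psf_le_trans (_ : (g * a + c) * (h * a + c) <=p _); last first.
  by rewrite ![_ * (h * a + c)]mulrC; apply: psf_mul_mono.
have -> : (g * a + c) * (h * a + c) = (g * h) * (a * a) + (a * c * (g + h) + c * c).
  by ring.
rewrite gh mul1r; apply: psf_le_eq (psf_add_mono (a * a + c * c)
  (psf_mul_mono (a * c) (sum_inv_ge2 Gg gh))) _ _; ring.
Qed.

(** Suppose [n + s] is constant for [s <= t], with weights [n] and 1 (here [n]
    abbreviates the positive multiplicity and [N = n + 1]), and let [k < 1] be the
    mean value [(n + t) / N].  Choose [z] just beyond the flat range, in the sense
    that [k z] lies in the range and [z] does not.  Sum up the matrix with [n] rows
    [(1, ..., 1, z)] and one row [(1, ..., 1, t z)]: by columns it is
    [N (n + k z)], which is equivalent to [N N k].  By rows, the last row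
    contributes at least [N k], whereas each of the others exceeds [N k]; by
    [mean_gt1] the total exceeds [N N k] strictly. *)
Lemma not_flat n t : sim1 t ->
  ~ (forall s, sim1 s -> s <=p t -> n.+1%:R + t <=p n.+1%:R + s).
Proof.
move=> Gt flat; have [v Gv uv] := sim1V sim1_u.
have v1 := inv_nle1 uv hu.2.
have EN : n.+2%:R = 1 + n.+1%:R :> F by rewrite mulrS.
have lt1 s : sim1 s -> ~ 1 <=p s -> ~ n.+2%:R <=p n.+1%:R + s.
  move=> Gs s1 le; have [q [Gq q1]] := mean_lt1 n.+1 0 Gs s1.
  rewrite mul1r addn1 => leq; apply: q1; apply: (psf_le_mul2l (@natrS_neq0 n.+1)).
  by rewrite mulr1; apply: psf_le_trans leq.
set p : F := n.+1%:R in EN flat lt1 *; set N : F := n.+2%:R in EN lt1 *.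
have N0 : N <> 0 by apply: natrS_neq0.
have t1 : ~ 1 <=p t.
  move=> t1; apply: (lt1 v) => //.
  apply: psf_le_trans (_ : p + t <=p _).
    by rewrite EN addrC; apply: psf_add_mono.
  apply: flat => //; apply: psf_le_trans t1.
  exact: sim1_nle (sim1_1 F) Gv v1.
have [k Gk Ek] : exists2 k, sim1 k & p + t = N * k by apply: sim1_mean.
have k1 : ~ 1 <=p k.
  by move=> /(psf_mul_mono N); rewrite mulr1 -Ek; apply: lt1.
have [k' Gk' kk'] := sim1V Gk.
have [z [Gz Tkz nTz]] : exists z,
    [/\ sim1 z, p + k * z <=p p + t & ~ p + z <=p p + t].
  apply: contrapT => nex.
  have step z : sim1 z -> p + k * z <=p p + t -> p + z <=p p + t.
    by move=> Gz kz; apply: contrapT => nz; apply: nex; exists z.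
  have all i : p + k' ^+ i * t <=p p + t.
    elim: i => [|i IHi]; first by rewrite mul1r; apply: psf_le_refl.
    apply: step; first exact: sim1M (sim1X _ Gk') Gt.
    by rewrite exprS -mulrA mulrA kk' mul1r.
  have [t' Gt' tt'] := sim1V Gt.
  have [i ti] := sim1_arch Gk' (inv_nge1 kk' k1) Gt'.
  apply: (lt1 t) => //; apply: psf_le_trans (all i).
  rewrite EN addrC; apply: psf_add_mono.
  by apply: psf_le_eq (psf_mul_mono t ti) _ _; rewrite // mulrC.
have [w Gw Ew] : exists2 w, sim1 w & p + z = N * w by apply: sim1_mean.
have wk : ~ w <=p k by move=> /(psf_mul_mono N); rewrite -Ew -Ek.
have tz : p + t <=p p + t * z.
  have [le|le] := sim1_total (sim1M Gt Gz) Gt; last exact: psf_add_mono.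
  by apply: flat le; apply: sim1M.
have : p * (p + z) + (p + t) <=p N * (p + t).
  apply: psf_le_trans (psf_add_mono (p * (p + z)) tz) _.
  apply: psf_le_eq (psf_mul_mono N Tkz) _ _ => //.
  have -> : N * (p + k * z) = N * p + (N * k) * z by ring.
  by rewrite -Ek EN; ring.
rewrite Ew Ek (_ : _ + _ = N * (p * w + k)); last by ring.
move=> /(psf_le_mul2l N0) pwk.
have wk1 : ~ w * k' <=p 1.
  move=> /(psf_mul_mono k); rewrite mulrCA kk' !mulr1; exact: wk.
have [q [Gq q1]] := mean_gt1 1 n (sim1M Gw Gk') wk1.
rewrite add1n -/p -/N => leq; apply: q1; apply: (psf_le_mul2l N0).
apply: psf_le_trans leq _.
apply: psf_le_eq (psf_mul_mono k' pwk) _ _.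
  by rewrite mulrDr [k' * k]mulrC kk'; ring.
by rewrite mulrCA [k' * k]mulrC kk' mulr1.
Qed.

(** A failure of strictness survives adding a complement of [c], which turns [c]
    into a multiple of a group element; then [flat_left] and [not_flat] collide. *)
Lemma add_strict c g : sim1 g -> ~ g <=p 1 -> ~ g + c <=p 1 + c.
Proof.
move=> Gg g1 gc; have [z [n [h [Gh cz]]]] := complement c.
have {gc cz}/(flat_left Gg g1) flat : g + n.+1%:R * h <=p 1 + n.+1%:R * h.
  by rewrite -cz !addrA ![_ + z]addrC; apply: psf_add_mono.
have [t Gt ht] := sim1V Gh; apply: (@not_flat n t Gt) => s Gs st.
have sh1 : s * h <=p 1.
  by apply: psf_le_eq (psf_mul_mono h st) _ _; rewrite // mulrC.
apply: psf_le_eq (psf_mul_mono t (flat _ (sim1M Gs Gh) sh1)) _ _.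
  by rewrite mulrDr mulr1 mulrCA [t * h]mulrC ht mulr1 addrC.
by rewrite mulrDr ![t * (_ * h)]mulrCA [t * h]mulrC ht !mulr1 addrC.
Qed.

Lemma psf_le_add2r c x y : sim x y -> x + c <=p y + c -> x <=p y.
Proof.
move=> xy xcyc; apply: contrapT => nxy.
have [x0|x0] := EM (x = 0).
  by apply: nxy; rewrite x0; apply: sim_ge0; rewrite -x0.
have [y0|y0] := EM (y = 0); last first.
  have [g Gg Eg] := sim1_divE x0 y0 xy.
  apply: (@add_strict (sinv y * c) g) => //.
    by move=> /(psf_mul_mono y); rewrite mulr1 -Eg.
  apply: (psf_le_mul2l y0).
  by rewrite !mulrDr mulr1 mulrA mulf_sinv // mul1r -Eg.
(* With [y = 0] all elements are related to 0, so [1 <= 2] strictly and [g = 2]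
   can be cancelled instead. *)
rewrite {y}y0 in xy xcyc nxy *.
have s01 : sim 0 (1 : F).
  have := sim_mull (sinv x) xy; rewrite mulr0 mulrC mulf_sinv //.
  exact: sim_sym.
have ge01 := sim_ge0 s01.
have G2 : sim1 (2 : F).
  split; first exact: natrS_neq0.
  by apply: sim_trans (sim_addl 1 (sim_sym s01)) _; rewrite addr0; apply: sim_refl.
apply: (@add_strict (sinv x * c) 2) => //.
  move=> le21; apply: (temperate sim1_u hu.2).
  apply: psf_le_trans (_ : 1 * u <=p _).
    by rewrite ![_ * u]mulrC; apply: psf_mul_mono.
  by apply: psf_le_eq (psf_add_mono u ge01) _ _; ring.
apply: (psf_le_mul2l x0).
rewrite !mulrDr mulr1 mulrA mulf_sinv // mul1r.
by apply: psf_le_eq (psf_add_mono x xcyc) _ _; ring.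
Qed.

(** Otherwise averaging with 1 keeps the element obtained from [g * g] above [g].
    As long as an element [X] is at least [g], the mean of 1 and [X] is at most
    [q X] with the fixed factor [q = (1 + 1 / g) / 2 < 1]; the powers of [q]
    contradict the Archimedean property. *)
Lemma square_bound g : sim1 g -> ~ g <=p 1 ->
  exists n, g * g + n%:R <=p g + n%:R * g.
Proof.
move=> Gg g1; apply: contrapT => nex.
have [h Gh gh] := sim1V Gg.
have [q [Gq q1 Eq]] := half_lt1 Gh (inv_nle1 gh g1).
have [q' Gq' qq'] := sim1V Gq.
have iter k : g <=p g * g * q ^+ k /\
    exists n, n%:R + g * g <=p n.+1%:R * (g * g * q ^+ k).
  have low n X : n%:R + g * g <=p n.+1%:R * X -> sim1 X -> g <=p X.
    move=> le GX; apply: sim1_nle => // Xg; apply: nex; exists n.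
    rewrite addrC; apply: psf_le_trans le _.
    apply: psf_le_eq (psf_mul_mono n.+1%:R Xg) _ _ => //.
    by rewrite mulrS; ring.
  suff [n le] : exists n, n%:R + g * g <=p n.+1%:R * (g * g * q ^+ k).
    by split; [apply: low le _; apply: sim1M; [apply: sim1M|apply: sim1X] | exists n].
  elim: k => [|k [n le]].
    by exists 0%N; rewrite mulr1 mul1r add0r; apply: psf_le_refl.
  exists (n.+1 + n)%N; set X := g * g * q ^+ k in le.
  have GX : sim1 X by apply: sim1M; [apply: sim1M|apply: sim1X].
  have gX := low _ _ le GX.
  apply: psf_le_trans (_ : n.+1%:R * (1 + X) <=p _).
    apply: psf_le_eq (psf_add_mono n.+1%:R le) _ _; rewrite ?natrD; ring.
  apply: psf_le_trans (_ : n.+1%:R * (h * X + X) <=p _).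
    apply: psf_mul_mono; rewrite ![_ + X]addrC; apply: psf_add_mono.
    by apply: psf_le_eq (psf_mul_mono h gX) _ _; rewrite // mulrC.
  apply: psf_le_eq (psf_le_refl (n.+1%:R * X * (2 * q))) _ _.
    by rewrite -Eq; ring.
  by rewrite -addnS natrD exprSr /X; ring.
apply: q1; apply: psf_le_eq (psf_mul_mono q _) _ _; [|exact: qq'|exact: mulr1].
apply: (hA Gq'.1 Gg.1) => k.
apply: (psf_le_mul2l Gg.1).
apply: psf_le_eq (psf_mul_mono (q' ^+ k) (iter k).1) _ _; first exact: mulrC.
by rewrite mulrCA -exprMn [q' * q]mulrC qq' expr1n mulr1.
Qed.

(** The difference [x - y] is at most a multiple of [g - 1]. *)
Definition bounded g x y : Prop := exists n, x + n%:R <=p y + n%:R * g.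

Lemma bounded_trans g x y z : bounded g x y -> bounded g y z -> bounded g x z.
Proof.
move=> [n xy] [m yz]; exists (n + m)%N; rewrite natrD.
apply: psf_le_trans (_ : y + m%:R + n%:R * g <=p _).
  by apply: psf_le_eq (psf_add_mono m%:R xy) _ _; ring.
by apply: psf_le_eq (psf_add_mono (n%:R * g) yz) _ _; ring.
Qed.

(** [c (x - y) <= n c (g - 1) <= n m (g - 1)]; the detour is removed by
    cancellation. *)
Lemma boundedMl g c x y : sim1 g -> sim x y ->
  bounded g (c * g) c -> bounded g x y -> bounded g (c * x) (c * y).
Proof.
move=> Gg xy [m cg] [n le]; exists (n * m)%N; rewrite natrM.
apply: (@psf_le_add2r (c * n%:R + c * n%:R * g)).
  apply: sim_add (sim_mull _ xy) _; rewrite mulrC -[X in sim X _]mulr1.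
  rewrite mulrC [_ * g]mulrC; apply/sim_sym.
  exact: sim_mul Gg.2 (sim_refl _).
apply: psf_le_trans (_ : c * (y + n%:R * g) + n%:R * (c * g + m%:R) <=p _).
  by apply: psf_le_eq (psf_add_mono (n%:R * (c * g + m%:R)) (psf_mul_mono c le)) _ _; ring.
by apply: psf_le_eq (psf_add_mono (c * (y + n%:R * g)) (psf_mul_mono n%:R cg)) _ _; ring.
Qed.

(** Telescoping: both [g ^ i - 1] and [1 - h ^ i] are sums of terms [c (g - 1)] with
    [c] a power of [g] or of its inverse [h]; [square_bound] treats [c = g], and
    [2 <= g + h] treats [c = h]. *)
Lemma bounded_pow g h i : sim1 g -> ~ g <=p 1 -> g * h = 1 ->
  bounded g (g ^+ i) (h ^+ i).
Proof.
move=> Gg g1 gh.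
have Gh : sim1 h by have [h' Gh' gh'] := sim1V Gg; rewrite -[h]mul1r -gh' mulrAC gh mul1r.
have bh : bounded g (h * g) h.
  exists 1%N; rewrite [h * g]mulrC gh mul1r addrC [h + g]addrC.
  exact: sum_inv_ge2.
apply: (bounded_trans (y := 1)).
  elim: i => [|i IHi]; first by exists 0%N; rewrite mul0r; apply: psf_le_refl.
  apply: (bounded_trans (y := g * 1)).
    rewrite exprS; apply: boundedMl => //; first exact: (sim1X _ Gg).2.
    exact: square_bound.
  by exists 1%N; apply: psf_le_eq (psf_le_refl (g + 1)) _ _; ring.
elim: i => [|i IHi]; first by exists 0%N; rewrite mul0r; apply: psf_le_refl.
apply: (bounded_trans (y := h * 1)); first by rewrite mulr1 -gh mulrC.
by rewrite exprS; apply: boundedMl => //; apply/sim_sym/(sim1X _ Gh).2.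
Qed.

Lemma bounded_sim1 g x y : sim1 g -> ~ g <=p 1 -> sim1 x -> sim1 y -> bounded g x y.
Proof.
move=> Gg g1 Gx Gy; have [h Gh gh] := sim1V Gg; have [y' Gy' yy'] := sim1V Gy.
have [i xi] := sim1_arch Gg g1 Gx; have [j yj] := sim1_arch Gg g1 Gy'.
have le1X k : 1 <=p g ^+ k.
  have := psf_leX k (sim1_nle Gg (sim1_1 F) g1); by rewrite expr1n.
have [n le] := bounded_pow (i + j) Gg g1 gh; exists n.
apply: psf_le_trans (_ : g ^+ (i + j) + n%:R <=p _).
  rewrite ![_ + n%:R]addrC; apply: psf_add_mono; rewrite exprD.
  by rewrite -[x]mulr1; apply: psf_leM.
apply: psf_le_trans le _; rewrite ![_ + n%:R * g]addrC; apply: psf_add_mono.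
have ghk : g ^+ (i + j) * h ^+ (i + j) = 1 by rewrite -exprMn gh expr1n.
have y'g : y' <=p g ^+ (i + j).
  by rewrite exprD -[y']mul1r; apply: psf_leM.
apply: psf_le_eq (psf_mul_mono (y * h ^+ (i + j)) y'g) _ _.
  by rewrite mulrAC yy' mul1r.
by rewrite -mulrA [h ^+ _ * _]mulrC ghk mulr1.
Qed.

(** If [a = b f] with [f > 1], then [b (f - 1)] is at most [(b + z) (f - 1)] for a
    complement [z], that is, a multiple of a difference [h f - h] inside the
    group. *)
Lemma sim_bounded g x y : sim1 g -> ~ g <=p 1 -> sim x y -> bounded g x y.
Proof.
move=> Gg g1; have nz a b : b <> 0 -> sim a b -> bounded g a b.
  move=> b0 ab; have [le|nle] := EM (a <=p b).
    by exists 0%N; rewrite mul0r !addr0.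
  have [a0|a0] := EM (a = 0).
    by case: nle; rewrite a0; apply: sim_ge0; rewrite -a0.
  have [f Gf Ef] := sim1_divE a0 b0 ab; have [z [n [h [Gh bz]]]] := complement b.
  have f1 : 1 <=p f.
    apply: sim1_nle Gf (sim1_1 F) _ => /(psf_mul_mono b); by rewrite mulr1 -Ef.
  have [m hf] := bounded_sim1 Gg g1 (sim1M Gh Gf) Gh.
  exists (n.+1 * m)%N; rewrite natrM.
  apply: (@psf_le_add2r (n.+1%:R * h + n.+1%:R * h * f)).
    apply: sim_add ab _; rewrite -[X in sim X _]mulr1.
    exact/sim_mull/sim_sym/Gg.2.
  have key : a + n.+1%:R * h <=p b + n.+1%:R * h * f.
    rewrite -bz Ef.
    apply: psf_le_eq (psf_add_mono (b + b * f) (psf_mul_mono z f1)) _ _; ring.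
  apply: psf_le_trans (_ : b + n.+1%:R * h * f + n.+1%:R * (h * f + m%:R) <=p _).
    by apply: psf_le_eq (psf_add_mono (n.+1%:R * (h * f + m%:R)) key) _ _; ring.
  by apply: psf_le_eq (psf_add_mono (b + n.+1%:R * h * f) (psf_mul_mono n.+1%:R hf)) _ _; ring.
move=> xy; have [y0|/nz] := EM (y = 0); last exact.
have [x0|x0] := EM (x = 0); first by exists 0%N; rewrite x0 y0 mul0r; apply: psf_le_refl.
(* For [y = 0], the difference [x - 0] is rewritten as [2 x - x]. *)
rewrite {y}y0 in xy *; have := sim_addl x xy; rewrite addr0.
move=> /(nz _ _ x0)[n le]; exists n; apply: (@psf_le_add2r x).
  by apply: sim_add xy _; rewrite -[X in sim X _]mulr1; apply/sim_mull/sim_sym/Gg.2.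
by apply: psf_le_eq le _ _; ring.
Qed.

(** [sim_bounded] with the roles exchanged: if [x = y g], then [(u - 1) / y] is at
    most a multiple of [g - 1]. *)
Lemma sim_gap x y : sim x y -> ~ x <=p y ->
  exists n, n%:R * y + u <=p n%:R * x + 1.
Proof.
have nz a b : b <> 0 -> sim a b -> ~ a <=p b -> exists n, n%:R * b + u <=p n%:R * a + 1.
  move=> b0 ab nle; have [a0|a0] := EM (a = 0).
    by case: nle; rewrite a0; apply: sim_ge0; rewrite -a0.
  have [g Gg Eg] := sim1_divE a0 b0 ab.
  have g1 : ~ g <=p 1 by move=> /(psf_mul_mono b); rewrite mulr1 -Eg.
  have [|n le] := @sim_bounded g (sinv b * u) (sinv b) Gg g1.
    by rewrite -[X in sim _ X]mulr1; apply: sim_mull; exact: sim1_u.2.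
  exists n; rewrite Eg; apply: psf_le_eq (psf_mul_mono b le) _ _.
    by rewrite mulrDr mulrA mulf_sinv // mul1r addrC mulrC.
  by rewrite mulrDr mulf_sinv // addrC; ring.
move=> xy nle; have [y0|/nz] := EM (y = 0); last exact.
(* For [y = 0], compare [x] with the smaller nonzero element [x / u]. *)
rewrite {y}y0 in xy nle *.
have x0 : x <> 0 by move=> x0; apply: nle; rewrite x0; apply: psf_le_refl.
have [v Gv uv] := sim1V sim1_u.
have xv0 : x * v <> 0 by apply: semifield_mulf_neq0 Gv.1.
have xxv : sim x (x * v).
  by rewrite -[X in sim X _]mulr1; apply/sim_mull/sim_sym/Gv.2.
have nxv : ~ x <=p x * v.
  rewrite -[X in X <=p _]mulr1 => /(psf_le_mul2l x0); exact: inv_nle1 uv hu.2.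
have [n le] := nz _ _ xv0 xxv nxv.
exists n; apply: psf_le_trans le; rewrite ![_ + u]addrC; apply: psf_add_mono.
apply: psf_mul_mono; have := psf_mul_mono v (sim_ge0 (sim_sym xy)).
by rewrite mulr0 mulrC.
Qed.

(** Pairs [(a, b)] are read as differences [a - b]. *)
Definition gap_le (p q : F * F) : Prop := p.1 + q.2 <=p q.1 + p.2.

Lemma gap_archimedean_preorder :
  archimedean_preorder (fun p : F * F => sim p.1 p.2) gap_le (u, 1).
Proof.
have swap (p q : F * F) : sim p.1 p.2 -> sim q.1 q.2 -> sim (p.1 + q.2) (q.1 + p.2).
  by move=> Cp Cq; rewrite [q.1 + _]addrC; apply: sim_add Cp (sim_sym Cq).
have Cmul n (p : F * F) : sim p.1 p.2 -> sim ((p *+ n).1) ((p *+ n).2).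
  elim: n => [|n IHn] Cp; first exact: sim_refl.
  by rewrite mulrS; apply: sim_add => //; apply: IHn.
have mulrn1 (p : F * F) n : (p *+ n).1 = n%:R * p.1.
  by elim: n => [|n IHn]; rewrite ?mul0r // mulrS /= IHn mulrS; ring.
have mulrn2 (p : F * F) n : (p *+ n).2 = n%:R * p.2.
  by elim: n => [|n IHn]; rewrite ?mul0r // mulrS /= IHn mulrS; ring.
split=> /=.
- exact: sim_refl.
- by move=> p q Cp Cq; apply: sim_add.
- exact: sim1_u.2.
- move=> p q r Cp Cq Cr pq qr; apply: (@psf_le_add2r q.2); first exact: swap.
  apply: psf_le_trans (_ : q.1 + p.2 + r.2 <=p _).
    by apply: psf_le_eq (psf_add_mono r.2 pq) _ _; ring.
  by apply: psf_le_eq (psf_add_mono p.2 qr) _ _; ring.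
- by move=> p q Cp Cq; apply/hF/swap.
- move=> p q r Cp Cq Cr; rewrite /gap_le /=; split=> [le|le].
    apply: (@psf_le_add2r (r.1 + r.2)); first exact: swap.
    by apply: psf_le_eq le _ _; ring.
  by apply: psf_le_eq (psf_add_mono (r.1 + r.2) le) _ _; ring.
- by rewrite /gap_le /= addr0 add0r; exact: hu.2.
- move=> p Cp; have [n1 le1] := sim_bounded sim1_u hu.2 Cp.
  have [n2 le2] := sim_bounded sim1_u hu.2 (sim_sym Cp).
  have un n : n%:R <=p n%:R * u.
    by rewrite -[X in X <=p _]mulr1; apply: psf_mul_mono hu.1.
  exists (n1 + n2)%N; rewrite /gap_le /= mulrn1 mulrn2 /= natrD; split.
    by apply: psf_le_eq (psf_leD le1 (un n2)) _ _; ring.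
  by apply: psf_le_eq (psf_leD le2 (un n1)) _ _; ring.
- move=> p q Cp Cq npq; have [n le] := sim_gap (swap _ _ Cp Cq) npq.
  exists n; rewrite /gap_le /= !mulrn1 !mulrn2.
  by apply: psf_le_eq le _ _; ring.
Qed.

Variable R : realType.

Let ap := gap_archimedean_preorder.
Let f := @hoelder R (F * F)%type gap_le (u, 1).

(** Multiplication by [x] is monotone and additive on differences, hence scales the
    embedding; the factor is read off at [u - 1]. *)
Let gap_mulr x (p : F * F) : sim p.1 p.2 -> f (x * p.1, x * p.2) = f (x * u, x) * f p.
Proof.
move=> Cp; rewrite -[X in (_ * u, X)]mulr1.
apply: (hoelder_unique ap (psi := fun p => f (x * p.1, x * p.2))) => // [q r|q r].
  move=> Cq Cr; rewrite /= !mulrDr.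
  exact: (hoelderD R ap (x := (_, _)) (y := (_, _)) (sim_mull x Cq) (sim_mull x Cr)).
move=> Cq Cr qr.
apply: (hoelder_homo R ap (x := (_, _)) (y := (_, _))); rewrite /gap_le /=.
- exact: sim_mull.
- exact: sim_mull.
- by rewrite -!mulrDr; apply: psf_mul_mono.
Qed.

Let phi x : R := f (x * u, x).

Let sim_xu x : sim (x * u) x.
Proof. by rewrite -[X in sim _ X]mulr1; apply/sim_mull/sim1_u.2. Qed.

Let phi0 : phi 0 = 0.
Proof.
rewrite /phi mul0r.
by have := hoelderMn R ap 0 (x := (0, 0)) (sim_refl 0); rewrite mul0r.
Qed.

Let phiD x y : phi (x + y) = phi x + phi y.
Proof.
rewrite /phi mulrDl.
exact: (hoelderD R ap (x := (_, _)) (y := (_, _)) (sim_xu x) (sim_xu y)).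
Qed.

Let phi1 : phi 1 = 1.
Proof. by rewrite /phi mul1r; apply: (hoelder_unit R ap). Qed.

Let phiM x y : phi (x * y) = phi x * phi y.
Proof. by rewrite /phi -mulrA -(gap_mulr x (p := (_, _)) (sim_xu y)). Qed.

Let phi_ge0 x : 0 <= phi x.
Proof.
rewrite -phi0; apply: (hoelder_homo R ap (x := (_, _)) (y := (_, _))) => //=.
rewrite /gap_le /= mul0r add0r addr0 -[X in X <=p _]mulr1.
exact: psf_mul_mono hu.1.
Qed.

Theorem temperate_representation : exists phi : {rmorphism F -> Rplus R},
  forall x y, sim x y -> (x <=p y <-> phi x <=p phi y).
Proof.
pose psi x : Rplus R := MkRplus (phi_ge0 x).
have [||||g gE] := @rmorphism_exists F (Rplus R) psi.
- exact/val_inj/phi0.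
- by move=> x z; apply/val_inj/phiD.
- exact/val_inj/phi1.
- by move=> x z; apply/val_inj/phiM.
exists g => x y xy; rewrite !gE.
change (x <=p y <-> phi x <= phi y).
have le_f : x <=p y <-> f (x, y) <= 0.
  rewrite -phi0 /phi mul0r.
  apply: iff_trans (le_hoelder R ap (x := (_, _)) (y := (_, _)) _ _) => //=.
    by rewrite /gap_le /= addr0 add0r.
  exact: sim_refl.
have phi_u : 0 < phi u - 1.
  rewrite subr_gt0 -phi1 ltNge; apply/negP.
  move=> /(le_hoelder R ap (x := (_, _)) (y := (_, _)) (sim_xu u) (sim_xu 1)).2.
  rewrite /gap_le /= mul1r => le; apply: (square_gt0 sim1_u hu.2).
  by apply: psf_le_eq le _ _; ring.
(* As differences, [(x u - x) + (x - y)] and [u (x - y) + (y u - y)] agree. *)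
suff Ephi : phi x + f (x, y) = phi u * f (x, y) + phi y.
  rewrite -subr_le0 (_ : phi x - phi y = (phi u - 1) * f (x, y)).
    by rewrite pmulr_rle0.
  by rewrite mulrBl mul1r; apply/eqP; rewrite subr_eq addrAC -Ephi addrK.
rewrite -(gap_mulr u (p := (x, y)) xy) /phi.
have Cux : sim (u * x) (u * y) by apply: sim_mull.
rewrite -(hoelderD R ap (x := (_, _)) (y := (_, _)) (sim_xu x) xy).
rewrite -(hoelderD R ap (x := (_, _)) (y := (_, _)) Cux (sim_xu y)).
have C1 : sim (x * u + x) (x + y) by apply: sim_add (sim_xu x) xy.
have C2 : sim (u * x + y * u) (u * y + y) by apply: sim_add Cux (sim_xu y).
have E : x * u + x + (u * y + y) = u * x + y * u + (x + y) by ring.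
apply/le_anti/andP; split;
  apply: (hoelder_homo R ap (x := (_, _)) (y := (_, _))) => //;
  by rewrite /gap_le /= E; apply: psf_le_refl.
Qed.

End Temperate.

End FullyPreordered.

(** * Max-temperate and max-tropical preorders as inequalities in the group *)

Section Types.
Variables (F : preorderedSemifieldType) (hF : fully_preordered F).
Implicit Types g h : F.

Lemma sim1_gt1 g : sim1 g -> ~ g <=p 1 -> 1 <p g.
Proof. by move=> Gg g1; split=> //; apply: sim1_nle (sim1_1 F) g1. Qed.

Lemma mul_add_sinv g : g <> 0 -> g * (g + sinv g) = 1 + g * g.
Proof. by move=> g0; rewrite mulrDr mulf_sinv // addrC. Qed.

Lemma square_ge0_of_gt1 :
  (forall g, sim1 g -> 1 <p g -> 2 <=p g + sinv g) ->
  forall g, sim1 g -> 2 * g <=p 1 + g * g.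
Proof.
move=> hgt; have gt1 g : sim1 g -> ~ g <=p 1 -> 2 * g <=p 1 + g * g.
  move=> Gg g1; rewrite -(mul_add_sinv Gg.1) mulrC.
  exact/psf_mul_mono/hgt/sim1_gt1.
move=> g Gg; have [g1|/(gt1 _ Gg)//] := EM (g <=p 1).
have [ge1|ng1] := EM (1 <=p g).
  have := psf_leD g1 (psf_mul_mono g ge1).
  by move/psf_le_eq; apply=> //; ring.
have [h Gh gh] := sim1V Gg.
apply: psf_le_eq (psf_mul_mono (g * g) (gt1 h Gh (inv_nge1 gh ng1))) _ _.
  by have -> : g * g * (2 * h) = 2 * g * (g * h); [ring | rewrite gh mulr1].
have -> : g * g * (1 + h * h) = g * g + (g * h) * (g * h) by ring.
by rewrite gh mulr1 addrC.
Qed.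

Lemma max_temperate_square_ge0 : max_temperate F ->
  forall g, sim1 g -> 2 * g <=p 1 + g * g.
Proof.
by move=> hT; apply: square_ge0_of_gt1 => g Gg /(hT _ Gg.1)[[]].
Qed.

Lemma max_tropical_square_ge0 : max_tropical F ->
  forall g, sim1 g -> 2 * g <=p 1 + g * g.
Proof.
move=> hT; apply: square_ge0_of_gt1 => g Gg g1.
apply: psf_le_trans (hT _ Gg.1 g1).2.
by have := psf_mul_mono 2 g1.1; rewrite mulr1.
Qed.

Lemma max_temperate_square_gt0 : max_temperate F ->
  forall g, sim1 g -> ~ g <=p 1 -> ~ 1 + g * g <=p 2 * g.
Proof.
move=> hT g Gg /(sim1_gt1 Gg) /(hT _ Gg.1)[[_ n2] _].
by rewrite -(mul_add_sinv Gg.1) [2 * g]mulrC => /(psf_le_mul2l Gg.1).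
Qed.

(** If [2 g <= 1 + g], then squaring gives [4 g ^ 2 <= (1 + g) ^ 2], which is at most
    [2 (1 + g ^ 2)]; so [2 g ^ 2 <= 1 + g ^ 2], contradicting [g + 1 / g < 2 g]. *)
Lemma max_temperate_lt (u : F) : 1 <p u -> max_temperate F ->
  forall g, sim1 g -> ~ g <=p 1 -> ~ 2 * g <=p 1 + g.
Proof.
move=> hu hT g Gg g1 le; have [_ [_]] := hT _ Gg.1 (sim1_gt1 Gg g1); apply.
apply: (psf_le_mul2l Gg.1); rewrite mul_add_sinv; last exact: Gg.1.
apply: (psf_le_mul2l (natrS_neq0 hu (n := 1))).
apply: psf_le_trans (_ : (1 + g) * (1 + g) <=p _).
  by apply: psf_le_eq (psf_leM le le) _ _ => //; ring.
apply: psf_le_eq (psf_add_mono (1 + g * g)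
  (max_temperate_square_ge0 hT Gg)) _ _; ring.
Qed.

(** The defining inequality is about [1 + g ^ 2]; adding [2 g] turns it into
    [2 g (1 + g) <= (1 + g) ^ 2]. *)
Lemma max_tropical_le (u : F) : 1 <p u -> max_tropical F ->
  forall g, sim1 g -> 1 <=p g -> 2 * g <=p 1 + g.
Proof.
move=> hu hT g Gg ge1; have [g1|g1] := EM (g <=p 1).
  by apply: psf_le_eq (psf_add_mono g g1) _ _; ring.
apply: (@psf_le_mul2l _ (1 + g)).
  exact/(addf_neq0 hu)/semifield_one_neq0.
have := psf_mul_mono g (hT _ Gg.1 (sim1_gt1 Gg g1)).2.
rewrite mul_add_sinv; last exact: Gg.1.
by move/(psf_add_mono (2 * g))/psf_le_eq; apply; ring.
Qed.

End Types.

(** * The representation theorem *)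

Theorem proposition6p7 (R : realType) (F : preorderedSemifieldType) (u : F)
  (hF : fully_preordered F) (hA : mult_archimedean F)
  (hu0 : u <> 0) (hu : 1 <p u)
  (htype : max_temperate F \/ max_tropical F)
  (hquasi : quasi_complements (sim_quot F)) :
  (exists phi : {rmorphism F -> Rplus R},
     forall x y : F, sim x y -> (x <=p y <-> phi x <=p phi y)) \/
  (exists phi : {rmorphism F -> TRplus R},
     forall x y : F, sim x y -> (x <=p y <-> phi x <=p phi y)).
Proof.
case: htype => hT; [left | right].
  apply: (temperate_representation hF hA hu0 hu) hquasi _ _ R.
  - exact: max_temperate_square_ge0.
  - exact: max_temperate_lt hu hT.
  - exact: max_temperate_square_gt0.
apply: (tropical_representation hF hA hu0 hu) hquasi _ R.
  exact: max_tropical_square_ge0.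
exact: max_tropical_le hu hT.
Qed.
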